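(* Let $(\mathcal{O},*,\mathrm{n})$ be an Okubo algebra over a field $\mathbb{F}$. The following conditions are equivalent: (i) The norm $\mathrm{n}$ is isotropic (i.e. $\mathrm{n}(u)=0$ for some $0\neq u\in\mathcal{O}$). (ii) There are scalars $\alpha,\beta\in\mathbb{F}^\times$ such that $\mathcal{O}$ is isomorphic to $\mathcal{O}_{\alpha,\beta}$. (iii) $\mathcal{O}$ admits a special grading by an abelian group.
   Context: Split Okubo algebra. For a field $\mathbb{F}$, the split Okubo algebra $(\mathcal{O}_{\mathbb{F}},*,\mathrm{n})$ is the $8$-dimensional $\mathbb{F}$-algebra with basis $\{z_{i,j} : (i,j)\in(\mathbb{Z}/3)^2,\ (i,j)\neq(0,0)\}$ and multiplication $$z_{i,j}*z_{i',j'}=\begin{cases}0&\text{if }\Delta=2\text{ or }i+i'=0=j+j',\\ -z_{i+i',j+j'}&\text{if }\Delta=1,\\ z_{i+i',j+j'}&\text{otherwise,}\end{cases}\qquad \Delta=ij'-ji'\in\mathbb{Z}/3,$$ endowed with the quadratic form $\mathrm{n}$ determined by $\mathrm{n}(z_{i,j})=0$ for all $(i,j)\ne(0,0)$ and polar form $\mathrm{n}(u,v)=\mathrm{n}(u+v)-\mathrm{n}(u)-\mathrm{n}(v)$ satisfying $\mathrm{n}(z_{i,j},z_{i',j'})=1$ if $i+i'=0=j+j'$ and $0$ otherwise. Okubo algebras. An Okubo algebra over $\mathbb{F}$ is a twisted form of $(\mathcal{O}_{\mathbb{F}},*,\mathrm{n})$, i.e. a triple $(\mathcal{O},*,\mathrm{n})$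 with $\mathcal{O}$ an $\mathbb{F}$-vector space, $*$ a bilinear product and $\mathrm{n}$ a quadratic form (the norm), that becomes isomorphic to the split Okubo algebra over an algebraic closure $\overline{\mathbb{F}}$ after extending scalars to $\overline{\mathbb{F}}$. The algebras $\mathcal{O}_{\alpha,\beta}$. For $\alpha,\beta\in\mathbb{F}^\times$, fix cubic roots $\alpha^{1/3},\beta^{1/3}\in\overline{\mathbb{F}}$. Then $\mathcal{O}_{\alpha,\beta}$ is the $\mathbb{F}$-subspace of $\mathcal{O}_{\overline{\mathbb{F}}}$ with $\mathbb{F}$-basis $\tilde z_{i,j}=\alpha^{i/3}\beta^{j/3}z_{i,j}$, for integers $0\le i,j\le 2$, $(i,j)\neq(0,0)$, with the restricted product and norm. It is an Okubo algebra over $\mathbb{F}$. Explicitly, if $z_{i,j}*z_{i',j'}=\epsilon\, z_{i+i',j+j'}$ with $\epsilon\in\{0,1,-1\}$, then $\tilde z_{i,j}*\tilde z_{i',j'}=\epsilon\,\alpha^{\lfloor (i+i')/3\rfloor}\beta^{\lfloor (j+j')/3\rfloor}\tilde z_{k,l}$, where $k,l\in\{0,1,2\}$ are the residues of $i+i'$, $j+j'$ modulo $3$. Special gradings. A grading $\Gamma:\mathcal{A}=\bigoplus_{g\in G}\mathcal{A}_g$ of an algebra $\mathcal{A}$ by an abelian group $G$ (so $\mathcal{A}_g\mathcal{A}_h\subseteq\mathcal{A}_{gh}$) is called special if the component of the neutral element is trivial: $\mathcal{A}_e=0$. *)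

(* Defs.v *)
From mathcomp Require Import all_boot all_algebra ring.

Set Implicit Arguments.
Unset Strict Implicit.
Unset Printing Implicit Defensive.

Import GRing.Theory.
Local Open Scope ring_scope.

Definition polar (F : fieldType) (V : lmodType F) (n : V -> F) (u v : V) : F :=
  n (u + v) - n u - n v.

Definition quadratic_form (F : fieldType) (V : lmodType F) (n : V -> F) : Prop :=
  (forall (c : F) (u : V), n (c *: u) = c ^+ 2 * n u)
  /\ bilinear_for *%R *%R (polar n).

(* The only algebras with norm considered are twisted forms of an algebra of   *)
(* dimension 8, hence finite-dimensional.                                      *)
Record normed_algebra (F : fieldType) := NormedAlgebra {
  space_of :> vectType F;
  mul_of : space_of -> space_of -> space_of;
  norm_of : space_of -> F;
  mul_of_bilinear : bilinear_for *:%R *:%R mul_of;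
  norm_of_quadratic : quadratic_form norm_of }.

Arguments mul_of {F n} _ _ : rename.
Arguments norm_of {F n} _ : rename.

Notation "u ** v" := (mul_of u v) (at level 40, left associativity) : ring_scope.

Definition isomorphic (F : fieldType) (A B : normed_algebra F) : Prop :=
  exists f : {linear A -> B},
    [/\ bijective f,
        forall u v : A, f (u ** v) = f u ** f v
      & forall u : A, norm_of (f u) = norm_of u].

Section TableAlgebra.
Variables (F : fieldType) (I : finType).
Local Notation V := {ffun I -> F^o}.

Definition coord_vector (p : I) : V := [ffun r => (r == p)%:R].

Definition bilin_ext (W : lmodType F) (c : I -> I -> W) (x y : I -> F) : W :=
  \sum_p \sum_r (x p * y r) *: c p r.

(* The quadratic form with value q p at the p-th coordinate vector and polar   *)
(* form b p r at the p-th and r-th ones, for p before r in enum I.             *)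
Definition quad_ext (q : I -> F) (b : I -> I -> F) (x : I -> F) : F :=
  \sum_p x p ^+ 2 * q p
  + \sum_p \sum_(r | (enum_rank p < enum_rank r)%N) x p * x r * b p r.

Lemma bilin_ext_bilinear (W : lmodType F) (c : I -> I -> W) :
  bilinear_for *:%R *:%R (fun x y : V => bilin_ext c x y).
Proof.
split=> z a x y; rewrite /bilin_ext /= scaler_sumr -big_split /=;
  apply: eq_bigr => p _; rewrite scaler_sumr -big_split /=;
  apply: eq_bigr => r _; rewrite !ffunE scalerA -scalerDl; congr (_ *: _).
- by rewrite mulrDl mulrA.
- by rewrite mulrDr mulrCA.
Qed.

Let cross (q : I -> F) (b : I -> I -> F) (x y : I -> F) : F :=
  \sum_p x p * y p * q p *+ 2
  + \sum_p \sum_(r | (enum_rank p < enum_rank r)%N)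
       (x p * y r + y p * x r) * b p r.

Let quad_ext_eq q b (x y : I -> F) : x =1 y -> quad_ext q b x = quad_ext q b y.
Proof.
move=> xy; rewrite /quad_ext; congr (_ + _); apply: eq_bigr => p _.
  by rewrite xy.
by apply: eq_bigr => r _; rewrite !xy.
Qed.

Let quad_extD q b (x y : I -> F) :
  quad_ext q b (fun p => x p + y p)
  = quad_ext q b x + quad_ext q b y + cross q b x y.
Proof.
rewrite /quad_ext /cross [X in _ = X + _]addrACA [RHS]addrACA.
congr (_ + _); rewrite -!big_split; apply: eq_bigr => p _ /=; first by ring.
by rewrite -!big_split; apply: eq_bigr => r _ /=; ring.
Qed.

Let quad_extZ q b a (x : I -> F) :
  quad_ext q b (fun p => a * x p) = a ^+ 2 * quad_ext q b x.
Proof.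
rewrite /quad_ext mulrDr !mulr_sumr; congr (_ + _); apply: eq_bigr => p _.
  by ring.
by rewrite mulr_sumr; apply: eq_bigr => r _; ring.
Qed.

Let cross_eq q b (x x' y y' : I -> F) :
  x =1 x' -> y =1 y' -> cross q b x y = cross q b x' y'.
Proof.
move=> xx yy; rewrite /cross; congr (_ + _); apply: eq_bigr => p _.
  by rewrite xx yy.
by apply: eq_bigr => r _; rewrite !xx !yy.
Qed.

Let crossC q b (x y : I -> F) : cross q b x y = cross q b y x.
Proof.
rewrite /cross; congr (_ + _); apply: eq_bigr => p _; first by ring.
by apply: eq_bigr => r _; ring.
Qed.

Let crossP q b a (x y z : I -> F) :
  cross q b (fun p => a * x p + y p) z = a * cross q b x z + cross q b y z.
Proof.
rewrite /cross mulrDr addrACA !mulr_sumr.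
congr (_ + _); rewrite -!big_split; apply: eq_bigr => p _ /=; first by ring.
by rewrite mulr_sumr -!big_split; apply: eq_bigr => r _ /=; ring.
Qed.

Lemma quad_ext_quadratic q b : quadratic_form (fun x : V => quad_ext q b x).
Proof.
have polE (x y : V) : polar (fun x : V => quad_ext q b x) x y = cross q b x y.
  rewrite /polar (@quad_ext_eq _ _ _ (fun p => (x p : F) + y p)).
    by rewrite quad_extD; ring.
  by move=> p; rewrite ffunE.
split=> [c x|].
  by rewrite -quad_extZ; apply: quad_ext_eq => p; rewrite ffunE.
split=> z a x y /=; rewrite !polE.
  by rewrite -crossP; apply: cross_eq => // p; rewrite !ffunE.
rewrite ![cross q b z _]crossC -crossP.
by apply: cross_eq => // p; rewrite !ffunE.
Qed.

Definition table_algebra (c : I -> I -> V) (q : I -> F) (b : I -> I -> F) :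
    normed_algebra F :=
  NormedAlgebra (bilin_ext_bilinear c) (quad_ext_quadratic q b).

Lemma table_mul c q b (p r : I) :
  (coord_vector p : table_algebra c q b) ** coord_vector r = c p r.
Proof.
rewrite /= /bilin_ext (bigD1 p) //= [X in _ + X]big1 ?addr0 => [|i ip].
  rewrite (bigD1 r) //= big1 ?addr0 => [|j jr]; rewrite !ffunE !eqxx.
    by rewrite mulr1 scale1r.
  by rewrite (negPf jr) mulr0 scale0r.
by apply: big1 => j _; rewrite !ffunE (negPf ip) mul0r scale0r.
Qed.

Lemma table_norm c q b (p : I) :
  norm_of (coord_vector p : table_algebra c q b) = q p.
Proof.
rewrite /= /quad_ext (bigD1 p) //= big1 => [|i ip]; last first.
  by rewrite !ffunE (negPf ip) expr0n mul0r.
rewrite ffunE eqxx expr1n mul1r addr0 big1 ?addr0 // => i _.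
apply: big1 => j; rewrite !ffunE; case: (i =P p) => [->|_]; last by rewrite !mul0r.
by case: (j =P p) => [->|_]; rewrite ?ltnn // mulr0 mul0r.
Qed.

Lemma table_polar c q b (p r : I) :
  (forall i j, b i j = b j i) -> p != r ->
  polar norm_of (coord_vector p : table_algebra c q b) (coord_vector r) = b p r.
Proof.
move=> bC pr; rewrite /= (_ : polar _ _ _ = cross q b (coord_vector p) (coord_vector r)).
  wlog lt_pr : p r pr / (enum_rank p < enum_rank r)%N.
    move=> IH; case: (ltngtP (enum_rank p) (enum_rank r)) => [/IH->// | lt | eq].
      by rewrite crossC bC IH // eq_sym.
    by case/eqP: pr; apply/enum_rank_inj/val_inj.
  have rp : (r == p) = false by rewrite eq_sym (negPf pr).
  rewrite /cross big1 => [|i _].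
    rewrite add0r (bigD1 p) //= (bigD1 r) //= !ffunE !eqxx (negPf pr) rp.
    rewrite mulr1 mul0r addr0 mul1r !big1 ?addr0 // => [i ip|j /andP[_ jr]].
      apply: big1 => j ij; rewrite !ffunE (negPf ip) mul0r add0r.
      case: (i =P r) ij => [->|_ _]; last by rewrite !mul0r.
      case: (j =P p) => [->|_ _]; last by rewrite mulr0 mul0r.
      by rewrite ltnNge ltnW.
    by rewrite !ffunE (negPf jr) mulr0 mul0r addr0 mul0r.
  rewrite !ffunE; case: (i =P p) => [->|_]; last by rewrite !mul0r mul0rn.
  by rewrite (negPf pr) mulr0 mul0r mul0rn.
rewrite /polar (@quad_ext_eq _ _ _ (fun i => (coord_vector p i : F) + coord_vector r i)).
  by rewrite quad_extD; ring.
by move=> i; rewrite ffunE.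
Qed.

End TableAlgebra.

Section Tables.
Variables (F : fieldType) (A : normed_algebra F) (I : finType) (e : I -> A).
Implicit Types x y : {ffun I -> F^o}.

Lemma mul_suml (J : Type) (s : seq J) (f : J -> A) (v : A) :
  (\sum_(j <- s) f j) ** v = \sum_(j <- s) f j ** v.
Proof.
have [Hl _] := mul_of_bilinear A.
have H0 : 0 ** v = 0 by have := Hl v (-1) v v; rewrite /= !scaleN1r !addNr.
apply: (big_morph (fun u => u ** v)) => // u w.
by have := Hl v 1 u w; rewrite /= !scale1r.
Qed.

Lemma mul_sumr (J : Type) (s : seq J) (f : J -> A) (v : A) :
  v ** (\sum_(j <- s) f j) = \sum_(j <- s) v ** f j.
Proof.
have [_ Hr] := mul_of_bilinear A.
have H0 : v ** 0 = 0 by have := Hr v (-1) v v; rewrite /= !scaleN1r !addNr.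
apply: (big_morph (fun u => v ** u)) => // u w.
by have := Hr v 1 u w; rewrite /= !scale1r.
Qed.

Lemma mulZl a (u v : A) : (a *: u) ** v = a *: (u ** v).
Proof.
have [Hl _] := mul_of_bilinear A.
have := Hl v a u 0; rewrite /= addr0 => ->.
by have := mul_suml (nil : seq nat) (fun=> 0) v; rewrite !big_nil => ->; rewrite addr0.
Qed.

Lemma mulZr a (u v : A) : u ** (a *: v) = a *: (u ** v).
Proof.
have [_ Hr] := mul_of_bilinear A.
have := Hr u a v 0; rewrite /= addr0 => ->.
by have := mul_sumr (nil : seq nat) (fun=> 0) u; rewrite !big_nil => ->; rewrite addr0.
Qed.

Lemma mul_expand x y :
  (\sum_p x p *: e p) ** (\sum_r y r *: e r)
  = bilin_ext (fun p r => e p ** e r) x y.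
Proof.
rewrite mul_suml; apply: eq_bigr => p _; rewrite mul_sumr.
by apply: eq_bigr => r _; rewrite mulZl mulZr scalerA mulrC.
Qed.

Lemma polar_suml (J : Type) (s : seq J) (f : J -> A) (v : A) :
  polar norm_of (\sum_(j <- s) f j) v = \sum_(j <- s) polar norm_of (f j) v.
Proof.
have [_ [Hl _]] := norm_of_quadratic A.
have H0 : polar norm_of 0 v = 0.
  by have := Hl v (-1) v v; rewrite /= scaleN1r mulN1r !addNr.
apply: (big_morph (fun u => polar norm_of u v)) => // u w.
by have := Hl v 1 u w; rewrite /= scale1r mul1r.
Qed.

Lemma polarZ a b (u v : A) :
  polar norm_of (a *: u) (b *: v) = a * b * polar norm_of u v.
Proof.
have [_ [Hl Hr]] := norm_of_quadratic A.
have Z0 (w : A) : polar norm_of 0 w = 0.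
  by have := Hl w (-1) w w; rewrite /= scaleN1r mulN1r !addNr.
have R0 (w : A) : polar norm_of w 0 = 0.
  by have := Hr w (-1) w w; rewrite /= scaleN1r mulN1r !addNr.
have := Hl (b *: v) a u 0; rewrite /= !addr0 Z0 addr0 => ->.
have := Hr u b v 0; rewrite /= !addr0 R0 addr0 => ->.
by rewrite mulrA.
Qed.

Lemma norm_expand x :
  norm_of (\sum_p x p *: e p)
  = quad_ext (norm_of \o e) (fun p r => polar norm_of (e p) (e r)) x.
Proof.
have [nZ _] := norm_of_quadratic A.
have n0 : norm_of (0 : A) = 0.
  by have := nZ 0 0; rewrite scale0r expr0n mul0r.
have key m (f : 'I_m -> A) :
  norm_of (\sum_i f i) = \sum_i norm_of (f i)
    + \sum_(i < m) \sum_(j < m | (i < j)%N) polar norm_of (f i) (f j).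
  elim: m f => [|m IH] f; first by rewrite !big_ord0 n0 addr0.
  rewrite !big_ord_recr /= [X in _ + (_ + X)]big1 => [|j mj]; last first.
    by move: mj; rewrite ltnNge -ltnS ltn_ord.
  rewrite addr0 [X in _ = _ + X](eq_bigr (fun i : 'I_m =>
     \sum_(j < m | (i < j)%N)
        polar norm_of (f (widen_ord (leqnSn m) i)) (f (widen_ord (leqnSn m) j))
     + polar norm_of (f (widen_ord (leqnSn m) i)) (f ord_max))); last first.
    by move=> i _; rewrite big_mkcond big_ord_recr /= ltn_ord -big_mkcond.
  rewrite big_split /= -polar_suml addrACA -IH /polar.
  by ring.
have eV (P : simpl_pred I) : {on P, bijective (@enum_val I I)} by apply/onW_bij/enum_val_bij.
rewrite (reindex _ (eV _)) key /quad_ext (reindex _ (eV _)) /=; congr (_ + _).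
  by apply: eq_bigr => i _; rewrite nZ.
rewrite [RHS](reindex _ (eV _)) /=; apply: eq_bigr => i _.
rewrite [RHS](reindex _ (eV _)) /=; apply: eq_big => j; first by rewrite !enum_valK.
by move=> _; rewrite polarZ.
Qed.

End Tables.

Section BaseChange.
Variables (F K : fieldType) (iota : {rmorphism F -> K}) (A : normed_algebra F).

Let e (i : 'I_(\dim {:A})) : A := (vbasis {:A})`_i.

Definition base_change_vec (u : A) : {ffun 'I_(\dim {:A}) -> K^o} :=
  [ffun i => iota (coord (vbasis {:A}) i u)].

(* K (x)_F A, in coordinates with respect to the K-basis 1 (x) e_i, where e is *)
(* the basis vbasis {:A} of A; base_change_vec is u |-> 1 (x) u.               *)
Definition base_change : normed_algebra K :=
  table_algebra (fun i j => base_change_vec (e i ** e j))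
                (fun i => iota (norm_of (e i)))
                (fun i j => iota (polar norm_of (e i) (e j))).

Let expand (u : A) :
  u = \sum_i [ffun i => (coord (vbasis {:A}) i u : F^o)] i *: e i.
Proof.
rewrite [LHS](coord_vbasis (memvf u)).
by apply: eq_bigr => i _; rewrite ffunE.
Qed.

Lemma base_change_mul (u v : A) :
  base_change_vec (u ** v)
  = (base_change_vec u : base_change) ** base_change_vec v.
Proof.
apply/ffunP => k; rewrite [u in LHS]expand [v in LHS]expand mul_expand.
rewrite ffunE /= /bilin_ext linear_sum rmorph_sum sum_ffunE /=.
apply: eq_bigr => i _; rewrite linear_sum rmorph_sum sum_ffunE /=.
by apply: eq_bigr => j _; rewrite linearZ !ffunE /= !rmorphM.
Qed.

Lemma base_change_norm (u : A) :
  norm_of (base_change_vec u : base_change) = iota (norm_of u).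
Proof.
rewrite [u in RHS]expand norm_expand /= /quad_ext rmorphD !rmorph_sum /=.
congr (_ + _); apply: eq_bigr => i _.
  by rewrite !ffunE /= rmorphM rmorphXn.
rewrite rmorph_sum; apply: eq_bigr => j _.
by rewrite !ffunE /= !rmorphM.
Qed.

Lemma base_change_linear a (u v : A) :
  base_change_vec (a *: u + v)
  = iota a *: base_change_vec u + base_change_vec v.
Proof. by apply/ffunP => i; rewrite !ffunE linearP rmorphD rmorphM. Qed.

Lemma base_change_basis (i : 'I_(\dim {:A})) :
  base_change_vec (e i) = coord_vector K i.
Proof.
apply/ffunP => j; rewrite !ffunE coord_free ?(basis_free (vbasisP _)) //.
by rewrite rmorph_nat eq_sym.
Qed.

End BaseChange.

Section SplitOkubo.
Variable F : fieldType.

Definition okubo_index : finType := {p : 'Z_3 * 'Z_3 | p != 0}.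

Definition okubo_delta (p r : 'Z_3 * 'Z_3) : 'Z_3 := p.1 * r.2 - p.2 * r.1.

Definition okubo_eps (p r : 'Z_3 * 'Z_3) : F :=
  if (okubo_delta p r == 2) || (p + r == 0) then 0
  else if okubo_delta p r == 1 then -1 else 1.

(* The basis vector z_p, extended by z_0 = 0. *)
Definition okubo_z (p : 'Z_3 * 'Z_3) : {ffun okubo_index -> F^o} :=
  [ffun r => (val r == p)%:R].

Definition split_okubo : normed_algebra F :=
  table_algebra
    (fun p r : okubo_index => okubo_eps (val p) (val r) *: okubo_z (val p + val r))
    (fun=> 0)
    (fun p r : okubo_index => (val p + val r == 0)%:R).

(* alpha^floor((i + i')/3) beta^floor((j + j')/3), computed on representatives *)
(* in {0, 1, 2}. It also scales the polar form of okubo_ab, since the norm is  *)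
(* restricted along okubo_ab_embed below.                                      *)
Definition okubo_coef (alpha beta : F) (p r : 'Z_3 * 'Z_3) : F :=
  alpha ^+ ((p.1 + r.1) %/ 3)%N * beta ^+ ((p.2 + r.2) %/ 3)%N.

Definition okubo_ab (alpha beta : F) : normed_algebra F :=
  table_algebra
    (fun p r : okubo_index =>
       (okubo_eps (val p) (val r) * okubo_coef alpha beta (val p) (val r))
         *: okubo_z (val p + val r))
    (fun=> 0)
    (fun p r : okubo_index =>
       okubo_coef alpha beta (val p) (val r) * (val p + val r == 0)%:R).

Section Products.
Variables (alpha beta : F) (p r : 'Z_3 * 'Z_3).
Hypotheses (p0 : p != 0) (r0 : r != 0).

Let z_coord (s : okubo_index) : okubo_z (val s) = coord_vector F s.
Proof. by apply/ffunP => k; rewrite !ffunE val_eqE. Qed.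

Lemma split_okubo_mul :
  (okubo_z p : split_okubo) ** okubo_z r = okubo_eps p r *: okubo_z (p + r).
Proof.
rewrite -[p]/(val (Sub p p0 : okubo_index)) -[r]/(val (Sub r r0 : okubo_index)).
by rewrite !z_coord table_mul.
Qed.

Lemma split_okubo_norm : norm_of (okubo_z p : split_okubo) = 0.
Proof.
by rewrite -[p]/(val (Sub p p0 : okubo_index)) z_coord table_norm.
Qed.

Lemma split_okubo_polar :
  polar norm_of (okubo_z p : split_okubo) (okubo_z r) = (p + r == 0)%:R.
Proof.
have [<-|pr] := eqVneq p r.
  rewrite /polar -mulr2n -scaler_nat (norm_of_quadratic split_okubo).1.
  rewrite split_okubo_norm mulr0 !subr0.
  by case: p p0 => -[[|[|[|?]]] ?] [[|[|[|?]]] ?].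
rewrite -[p]/(val (Sub p p0 : okubo_index)) -[r]/(val (Sub r r0 : okubo_index)).
by rewrite !z_coord table_polar // => i j; rewrite addrC.
Qed.

End Products.

End SplitOkubo.

(* okubo_ab alpha beta is the F-subspace of split_okubo K spanned by the       *)
(* vectors alpha^(i/3) beta^(j/3) z_(i,j), with the restricted product and     *)
(* norm, for any choice of the cubic roots in an extension K.                  *)
Section OkuboSubspace.
Variables (F K : fieldType) (iota : {rmorphism F -> K}).
Variables (alpha beta : F) (a b : K).
Hypotheses (alpha0 : alpha != 0) (beta0 : beta != 0).
Hypotheses (a3 : a ^+ 3 = iota alpha) (b3 : b ^+ 3 = iota beta).

Definition okubo_ab_embed (x : okubo_ab alpha beta) : split_okubo K :=
  \sum_(p : okubo_index)
    (iota (x p) * (a ^+ (val p).1 * b ^+ (val p).2)) *: okubo_z K (val p).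

Let w (p : 'Z_3 * 'Z_3) : K := a ^+ p.1 * b ^+ p.2.

Let embedE x p : okubo_ab_embed x p = iota (x p) * w (val p).
Proof.
rewrite sum_ffunE (bigD1 p) //= big1 => [|r rp]; rewrite !ffunE.
  by rewrite eqxx addr0 [LHS]mulr1.
by rewrite val_eqE eq_sym (negPf rp) [LHS]mulr0.
Qed.

Let embedF x :
  okubo_ab_embed x = [ffun p => iota (x p) * w (val p)] :> {ffun _ -> K^o}.
Proof. by apply/ffunP => p; rewrite embedE ffunE. Qed.

Let w_mul p r : w p * w r = iota (okubo_coef alpha beta p r) * w (p + r).
Proof.
have E (c : K) (i j : 'Z_3) :
  c ^+ i * c ^+ j = (c ^+ 3) ^+ ((i + j) %/ 3)%N * c ^+ (i + j)%R.
  by rewrite -exprD {1}(divn_eq (i + j) 3) exprD mulnC exprM.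
rewrite /w /okubo_coef rmorphM !rmorphXn -a3 -b3 mulrACA !E /=.
by rewrite mulrACA.
Qed.

Lemma okubo_ab_embed_z (p : okubo_index) :
  okubo_ab_embed (okubo_z F (val p))
  = (a ^+ (val p).1 * b ^+ (val p).2) *: okubo_z K (val p).
Proof.
apply/ffunP => r; rewrite embedE !ffunE val_eqE rmorph_nat.
by case: eqP => [->|_]; rewrite ?mul0r /GRing.scale /= ?mulr0 ?mul1r ?mulr1.
Qed.

Lemma okubo_ab_embed_linear c (x y : okubo_ab alpha beta) :
  okubo_ab_embed (c *: x + y)
  = iota c *: okubo_ab_embed x + okubo_ab_embed y.
Proof.
apply/ffunP => r; rewrite embedE !ffunE !embedE rmorphD rmorphM mulrDl.
by rewrite -mulrA.
Qed.

Lemma okubo_ab_embed_inj : injective okubo_ab_embed.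
Proof.
have a0 : a != 0.
  by apply: contraNneq alpha0 => a0; rewrite -(fmorph_eq0 iota) -a3 a0 expr0n.
have b0 : b != 0.
  by apply: contraNneq beta0 => b0; rewrite -(fmorph_eq0 iota) -b3 b0 expr0n.
move=> x y /ffunP xy; apply/ffunP => r; have := xy r; rewrite !embedE.
have w0 : w (val r) != 0 by rewrite mulf_neq0 ?expf_neq0.
by move/(mulIf w0)/fmorph_inj.
Qed.

Lemma okubo_ab_embed_mul (x y : okubo_ab alpha beta) :
  okubo_ab_embed (x ** y) = okubo_ab_embed x ** okubo_ab_embed y.
Proof.
have aux (X Y E C W Wp Wr : K) : Wp * Wr = C * W ->
    X * Y * (E * C * 1) * W = X * Wp * (Y * Wr) * (E * 1).
  by move=> H; transitivity (X * Y * E * (Wp * Wr)); [rewrite H | ]; ring.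
rewrite (embedF x) (embedF y).
apply/ffunP => k; rewrite embedE /= /bilin_ext !sum_ffunE rmorph_sum mulr_suml.
apply: eq_bigr => p _; rewrite !sum_ffunE rmorph_sum mulr_suml.
apply: eq_bigr => r _; rewrite !ffunE /GRing.scale /=.
rewrite ![iota (_ * _)]rmorphM rmorph_nat.
have -> : iota (okubo_eps F (val p) (val r)) = okubo_eps K (val p) (val r).
  by rewrite /okubo_eps; do 2?case: ifP; rewrite ?rmorph0 ?rmorphN ?rmorph1.
case: (val k =P _) => [->|_]; last by rewrite !mulr0 mul0r.
by apply: aux; rewrite -rmorphM; apply: w_mul.
Qed.

Lemma okubo_ab_embed_norm (x : okubo_ab alpha beta) :
  norm_of (okubo_ab_embed x) = iota (norm_of x).
Proof.
have aux (X Y C W Wp Wr : K) : Wp * Wr = C * W -> W = 1 ->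
    X * Wp * (Y * Wr) * 1 = X * Y * (C * 1).
  by move=> H W1; transitivity (X * Y * (Wp * Wr)); [|rewrite H W1]; ring.
rewrite embedF /= /quad_ext rmorphD !rmorph_sum; congr (_ + _); apply: eq_bigr => p _.
  by rewrite !mulr0 rmorph0.
rewrite rmorph_sum; apply: eq_bigr => r _.
rewrite !ffunE; case: eqP => [pr0|_]; last by rewrite !mulr0 rmorph0.
rewrite (aux _ _ _ _ _ _ (w_mul _ _)); first by rewrite !mulr1 -!rmorphM.
by rewrite [_ + _]pr0 /w /= !expr0 mulr1.
Qed.

End OkuboSubspace.

(* (K, iota) is an algebraic closure of F when K is algebraically closed.      *)
Definition algebraic_extension (F K : fieldType) (iota : {rmorphism F -> K}) :=
  forall x : K, algebraicOver iota x.

Definition okubo_algebra (F : fieldType) (Fbar : closedFieldType)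
    (iota : {rmorphism F -> Fbar}) (A : normed_algebra F) : Prop :=
  isomorphic (base_change iota A) (split_okubo Fbar).

Definition isotropic_norm (F : fieldType) (A : normed_algebra F) : Prop :=
  exists2 u : A, u != 0 & norm_of u = 0.

(* The grading group is written additively. Gamma may be indexed by an infinite *)
(* group: the direct sum is expressed through finite sequences of degrees.     *)
Section Gradings.
Variables (F : fieldType) (A : normed_algebra F) (G : zmodType).

Definition grading (Gamma : G -> {vspace A}) : Prop :=
  [/\ forall u : A, exists s : seq G, u \in (\sum_(g <- s) Gamma g)%VS,
      forall (s : seq G) (u : G -> A), uniq s ->
        (forall g, u g \in Gamma g) -> \sum_(g <- s) u g = 0 ->
        forall g, g \in s -> u g = 0
    & forall g h (u v : A),
        u \in Gamma g -> v \in Gamma h -> u ** v \in Gamma (g + h)].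

Definition special (Gamma : G -> {vspace A}) : Prop := Gamma 0 = 0%VS.

End Gradings.

(* Main.v *)
Require Import Defs.
From HB Require Import structures.
From mathcomp Require Import all_boot all_algebra ring.
From Stdlib Require Import Classical.

(* The only inputs about Okubo algebras are the dimension, the identities        *)
(* (x y) x = n(x) y = x (y x) and n(x y, z) = n(x, y z) with n nondegenerate, and *)
(* the absence of a nonzero element commuting with everything; all of them        *)
(* descend from the split algebra to O.                                           *)
(* If x != 0 is homogeneous in a special grading and n(x) != 0, then comparing    *)
(* degrees in x (x x) = n(x) x puts x x in the zero component, so n(x) x = 0.     *)
(* Conversely, if w w = 0 and n(w) = 0 then u = w y satisfies n(u) = 0 and        *)
(* n(u, u u) = - n(w, y)^3, so an isotropic norm yields u with n(u) = 0 and       *)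
(* n(u, u u) != 0. Such a u induces a Z/3-grading <u, u u> + O_1 + O_2. If        *)
(* v v = 0 on all of O_1, then left multiplication by u is a scalar on O_1 and a  *)
(* combination of u and u u is central, a contradiction; from v v != 0 one gets   *)
(* a pair (u, v), possibly with a new u, such that v is in O_1 and                *)
(* n(v, v v) != 0. These u and v multiply like the basis elements of indices      *)
(* (1,0) and (0,1) of O_(alpha,beta), alpha = n(u, u u), beta = n(v, v v).        *)

Set Implicit Arguments.
Unset Strict Implicit.
Unset Printing Implicit Defensive.

Import GRing.Theory.
Local Open Scope ring_scope.

(** The split algebra is a symmetric composition algebra in which only 0 commutes with everything.
    Both properties descend to [O] ([okubo_symmetric]), so the equivalences can be proved over the
    base field.

    The implication from isotropy to a presentation rests on the cubic form [cubic x], that is n(x,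
    x x). An isotropic norm gives an isotropic [u] with nonzero cubic value ([isotropic_cubic]).
    Multiplication by [u] splits the algebra into three degrees, and triviality of the center yields
    a second generator [v] ([exists_generators]). The identities then force the whole multiplication
    table ([okubo_basis_mul]), and the norm and the dimension turn the resulting homomorphism into
    an isomorphism ([presentation_isomorphic]).

    The lines through the basis vectors of [okubo_ab] form a special grading
    ([okubo_ab_special_grading]). Conversely, a special grading forces its homogeneous elements to
    be isotropic ([special_grading_isotropic]). *)

Section Bilinearity.
Variables (F : fieldType) (A : normed_algebra F).
Implicit Types (a : F) (x y z : A).
Local Notation b := (polar norm_of).

(** * Bilinearity of the product and of the polar form *)

Lemma starDl x y z : (x + y) ** z = x ** z + y ** z.
Proof. by have := (mul_of_bilinear A).1 z 1 x y; rewrite /= !scale1r. Qed.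

Lemma starDr x y z : z ** (x + y) = z ** x + z ** y.
Proof. by have := (mul_of_bilinear A).2 z 1 x y; rewrite /= !scale1r. Qed.

Lemma star0l x : 0 ** x = 0.
Proof. by rewrite -(scale0r x) mulZl !scale0r. Qed.

Lemma star0r x : x ** 0 = 0.
Proof. by rewrite -(scale0r x) mulZr !scale0r. Qed.

Lemma starNl x y : (- x) ** y = - (x ** y).
Proof. by rewrite -scaleN1r mulZl scaleN1r. Qed.

Lemma starNr x y : x ** (- y) = - (x ** y).
Proof. by rewrite -scaleN1r mulZr scaleN1r. Qed.

Lemma polarC x y : b x y = b y x.
Proof. by rewrite /polar [x + y]addrC addrAC. Qed.

Lemma polarDl x y z : b (x + y) z = b x z + b y z.
Proof. by have := (norm_of_quadratic A).2.1 z 1 x y; rewrite /= scale1r mul1r. Qed.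

Lemma polarDr x y z : b z (x + y) = b z x + b z y.
Proof. by rewrite !(polarC z) polarDl. Qed.

Lemma polarZl a x y : b (a *: x) y = a * b x y.
Proof. by rewrite -[y]scale1r polarZ scale1r mulr1. Qed.

Lemma polarZr a x y : b x (a *: y) = a * b x y.
Proof. by rewrite polarC polarZl polarC. Qed.

Lemma polar0l x : b 0 x = 0.
Proof. by rewrite -(scale0r x) polarZl mul0r. Qed.

Lemma polar0r x : b x 0 = 0.
Proof. by rewrite polarC polar0l. Qed.

Lemma polarNl x y : b (- x) y = - b x y.
Proof. by rewrite -scaleN1r polarZl mulN1r. Qed.

Lemma polarNr x y : b x (- y) = - b x y.
Proof. by rewrite polarC polarNl polarC. Qed.

Lemma normZ a x : norm_of (a *: x) = a ^+ 2 * norm_of x.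
Proof. exact: (norm_of_quadratic A).1. Qed.

Lemma norm0 : norm_of (0 : A) = 0.
Proof. by rewrite -(scale0r (0 : A)) normZ expr0n mul0r. Qed.

Lemma normD x y : norm_of (x + y) = norm_of x + norm_of y + b x y.
Proof. by rewrite /polar; ring. Qed.

End Bilinearity.

(** * Symmetric composition algebras and their cubic form *)

Definition symmetric_composition (F : fieldType) (A : normed_algebra F) : Prop :=
  [/\ forall x y : A, (x ** y) ** x = norm_of x *: y,
      forall x y : A, x ** (y ** x) = norm_of x *: y,
      forall x y z : A, polar norm_of (x ** y) z = polar norm_of x (y ** z)
    & forall x : A, (forall y, polar norm_of x y = 0) -> x = 0].

Section SymmetricComposition.
Variables (F : fieldType) (A : normed_algebra F).
Hypothesis symA : symmetric_composition A.
Implicit Types (a : F) (x y z : A).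
Local Notation b := (polar norm_of).
Local Notation n := norm_of.

Let mulxyx x y : (x ** y) ** x = n x *: y. Proof. by case: symA. Qed.
Let mulx_yx x y : x ** (y ** x) = n x *: y. Proof. by case: symA. Qed.
Lemma polar_assoc x y z : b (x ** y) z = b x (y ** z).
Proof. by case: symA. Qed.

Lemma polar_cycle x y z : b (x ** y) z = b (y ** z) x.
Proof. by rewrite polar_assoc polarC. Qed.

(** Linearization of [(x ** y) ** x = n x *: y] in [x]; with [mul_swapr], the rewriting rule behind
    nearly all later products. *)
Lemma mul_swapl x y z : (x ** y) ** z = b x z *: y - (z ** y) ** x.
Proof.
have := mulxyx (x + z) y; rewrite starDl starDr starDl starDl !mulxyx normD !scalerDl.
by rewrite addrACA [_ + n z *: y]addrC addrACA => /addrI <-; rewrite addrK.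
Qed.

Lemma mul_swapr x y z : x ** (y ** z) = b x z *: y - z ** (y ** x).
Proof.
have := mulx_yx (x + z) y; rewrite starDl starDr starDr starDr !mulx_yx normD !scalerDl.
by rewrite addrACA [_ + n z *: y]addrC addrACA => /addrI <-; rewrite [RHS]addrC addKr.
Qed.

Lemma polar_inj x y : (forall z, b x z = b y z) -> x = y.
Proof.
case: symA => _ _ _ nondeg xy; apply/eqP; rewrite -subr_eq0; apply/eqP/nondeg => z.
by rewrite polarDl polarNl xy subrr.
Qed.

(** It suffices to test the finitely many vectors of a basis, so the search is decidable. *)
Lemma polar_neq0 x : x != 0 -> exists y, b x y != 0.
Proof.
case: symA => _ _ _ nondeg.
have [/existsP[i bi] _|] :=
  boolP [exists i : 'I_(\dim {:A}), b x (vbasis {:A})`_i != 0].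
  by exists (vbasis {:A})`_i.
rewrite negb_exists => /forallP b0 /eqP[]; apply: nondeg => y.
rewrite (coord_vbasis (memvf y)) polarC polar_suml big1 // => i _.
by rewrite polarZl polarC (eqP (negPn (b0 i))) mulr0.
Qed.

(** At the generators of indices (1,0) and (0,1) of [okubo_ab alpha beta] it takes the values alpha
    and beta. *)
Definition cubic x : F := b x (x ** x).

(** The trilinear form b(x, y z) is cyclic, so mixed terms come in threes; hence [cubic] is additive
    in characteristic 3. *)
Lemma cubicD x y :
  cubic (x + y)
  = cubic x + 3%:R * b (x ** x) y + 3%:R * b x (y ** y) + cubic y.
Proof.
rewrite /cubic !(starDl, starDr, polarDl, polarDr).
rewrite -[b x (x ** y)]polar_assoc -[b y (y ** x)]polar_assoc.
rewrite -[b x (y ** x)]polarC [b (y ** x) x]polar_assoc.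
rewrite -[b y (x ** y)]polarC [b (x ** y) y]polar_assoc.
rewrite ![b y (x ** x)]polarC ![b (y ** y) x]polarC; ring.
Qed.

Lemma cubicZ a x : cubic (a *: x) = a ^+ 3 * cubic x.
Proof. by rewrite /cubic mulZl mulZr !(polarZl, polarZr); ring. Qed.

Lemma mul_sqr_sqr x : (x ** x) ** (x ** x) = cubic x *: x - n x *: (x ** x).
Proof. by rewrite mul_swapl mulxyx mulZl. Qed.

(** Since [b w (w ** t) = b (w ** w) t = 0], the square of [w ** y] reduces to a combination of [w]
    and [y ** w]. *)
Lemma cubic_mul_nil w y : w ** w = 0 -> n w = 0 ->
  n (w ** y) = 0 /\ cubic (w ** y) = - b w y ^+ 3.
Proof.
move=> ww nw.
have bww t : b w (w ** t) = 0 by rewrite -polar_assoc ww polar0l.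
have w_eq0 t : t *: w = 0 -> t = 0 \/ w = 0.
  by move/eqP; rewrite scaler_eq0 => /orP[]/eqP; [left | right].
split.
  have := mulxyx (w ** y) w; rewrite (mulxyx w) nw scale0r star0l.
  move=> /esym/w_eq0[] // ->.
  by rewrite star0l norm0.
have sq : (w ** y) ** (w ** y) = b (y ** y) w *: w - b w y *: (y ** w).
  rewrite mul_swapl bww scale0r sub0r [w ** y ** y]mul_swapl starDl mulZl starNl.
  by rewrite [y ** y ** w ** w]mul_swapl ww star0l subr0 opprD opprK addrC.
rewrite /cubic sq polarDr polarZr polarNr polarZr [b (w ** y) w]polarC bww mulr0 add0r.
rewrite polar_assoc mul_swapr polarDr polarZr polarNr bww [b y w]polarC; ring.
Qed.

Lemma isotropic_cubic : isotropic_norm A ->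
  exists u : A, n u = 0 /\ cubic u != 0.
Proof.
case=> w0 w0_neq0 nw0.
have [gw|gw] := eqVneq (cubic w0) 0; last by exists w0.
have {w0 w0_neq0 nw0 gw} [w [w_neq0 nw ww]] :
    exists w : A, [/\ w != 0, n w = 0 & w ** w = 0].
  have [ww|ww] := eqVneq (w0 ** w0) 0; first by exists w0.
  (* With norm and cubic value of [w0] both zero, [mul_sqr_sqr] makes the square of [w0 ** w0]
     vanish. *)
  exists (w0 ** w0); split=> //; last by rewrite mul_sqr_sqr gw nw0 !scale0r subr0.
  have := mulxyx (w0 ** w0) w0; rewrite (mulxyx w0) nw0 scale0r star0l => /esym/eqP.
  by rewrite scaler_eq0 (negPf w0_neq0) orbF => /eqP.
have [y bwy] := polar_neq0 w_neq0.
have [nwy gwy] := cubic_mul_nil y ww nw.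
by exists (w ** y); split; rewrite // gwy oppr_eq0 expf_neq0.
Qed.

End SymmetricComposition.

(** * The Z/3-grading induced by an isotropic element *)

Section IsotropicElement.
Variables (F : fieldType) (A : normed_algebra F).
Hypothesis symA : symmetric_composition A.
Implicit Types (x y z w v : A).
Local Notation b := (polar norm_of).
Local Notation n := norm_of.

(* The components of degrees 1 and 2 in the Z/3-grading for which [u] and      *)
(* [u ** u] span the component of degree 0; [u ** _] acts invertibly on the     *)
(* former and [_ ** u] on the latter.                                          *)
Definition deg1 (u x : A) := x ** u = 0 /\ b x u = 0.
Definition deg2 (u x : A) := u ** x = 0 /\ b x u = 0.

Section Decomposition.
Variable u : A.
Hypotheses (nu : n u = 0) (gu : cubic u != 0).
Let swapl := mul_swapl symA.
Let swapr := mul_swapr symA.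
Let assoc := polar_assoc symA.
Local Notation alpha := (cubic u).

Let uxu x : (u ** x) ** u = 0.
Proof. by case: symA => -> _ _ _; rewrite nu scale0r. Qed.

Let u_xu x : u ** (x ** u) = 0.
Proof. by case: symA => _ -> _ _; rewrite nu scale0r. Qed.

Let u_neq0 : u != 0.
Proof. by apply: contraNneq gu => ->; rewrite /cubic polar0l. Qed.

Lemma polar_diag x : n x = 0 -> b x x = 0.
Proof.
by move=> nx; rewrite /polar nx !subr0 -mulr2n -scaler_nat normZ nx mulr0.
Qed.

Let buu : b u u = 0. Proof. exact: polar_diag. Qed.

(** [(x ** u) ** x = n x *: u] and [u] is nonzero. *)
Lemma norm_left_annihilator x : x ** u = 0 -> n x = 0.
Proof.
move=> xu; case: symA => /(_ x u) + _ _ _; rewrite xu star0l => /esym/eqP.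
by rewrite scaler_eq0 (negPf u_neq0) orbF => /eqP.
Qed.

Lemma norm_right_annihilator x : u ** x = 0 -> n x = 0.
Proof.
move=> xu; case: symA => _ /(_ x u) + _ _; rewrite xu star0r => /esym/eqP.
by rewrite scaler_eq0 (negPf u_neq0) orbF => /eqP.
Qed.

Lemma sqr_sqr : (u ** u) ** (u ** u) = alpha *: u.
Proof. by rewrite mul_sqr_sqr // nu scale0r subr0. Qed.

Lemma norm_sqr : n (u ** u) = 0.
Proof. exact: norm_left_annihilator. Qed.

(** With [norm_sqr], this shows that [u ** u] satisfies the hypotheses on [u] again. *)
Lemma cubic_sqr : cubic (u ** u) = alpha ^+ 2.
Proof. by rewrite {1}/cubic sqr_sqr polarZr polarC. Qed.

Lemma deg1D x y : deg1 u x -> deg1 u y -> deg1 u (x + y).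
Proof.
by case=> xu bx [yu cy]; split; rewrite ?starDl ?polarDl ?xu ?yu ?bx ?cy addr0.
Qed.

Lemma deg1Z a x : deg1 u x -> deg1 u (a *: x).
Proof. by case=> xu bx; split; rewrite ?mulZl ?polarZl ?xu ?bx ?scaler0 ?mulr0. Qed.

Lemma deg2Z a x : deg2 u x -> deg2 u (a *: x).
Proof. by case=> xu bx; split; rewrite ?mulZr ?polarZl ?xu ?bx ?scaler0 ?mulr0. Qed.

Lemma deg1_mull x : deg1 u x -> deg1 u (u ** x).
Proof. by case=> xu bx; split; rewrite ?uxu // assoc xu polar0r. Qed.

Lemma deg2_mulr x : deg2 u x -> deg2 u (x ** u).
Proof. by case=> xu bx; split; rewrite ?u_xu // assoc polarC assoc xu polar0r. Qed.

Lemma deg1_sqrl x : deg1 u x -> (u ** u) ** x = 0.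
Proof. by case=> xu bx; rewrite swapl polarC bx xu star0l scale0r subr0. Qed.

Lemma deg1_sqrr x : deg1 u x -> x ** (u ** u) = - (u ** (u ** x)).
Proof. by case=> xu bx; rewrite swapr bx scale0r sub0r. Qed.

Lemma deg2_sqrr x : deg2 u x -> x ** (u ** u) = 0.
Proof. by case=> xu bx; rewrite swapr bx xu star0r scale0r subr0. Qed.

Lemma deg2_sqrl x : deg2 u x -> (u ** u) ** x = - ((x ** u) ** u).
Proof. by case=> xu bx; rewrite swapl polarC bx scale0r sub0r. Qed.

(** [u ** (u ** x)] is [- x ** (u ** u)], and swapping the outer factors of [u ** (x ** (u ** u))]
    leaves [b u (u ** u) *: x]. Thus left multiplication by [u] is invertible in degree 1. *)
Lemma deg1_cube x : deg1 u x -> u ** (u ** (u ** x)) = - (alpha *: x).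
Proof.
move=> dx; rewrite -[u ** (u ** x)]opprK -deg1_sqrr // starNr swapr.
by case: dx => -> _; rewrite star0r subr0.
Qed.

Lemma deg2_cube x : deg2 u x -> ((x ** u) ** u) ** u = - (alpha *: x).
Proof.
move=> dx; rewrite -[x ** u ** u]opprK -deg2_sqrl // starNl swapl.
by case: dx => -> _; rewrite star0l subr0 polarC.
Qed.

Lemma polar_mul_adj x y : b (u ** x) y = b x (y ** u).
Proof. by rewrite polarC -assoc polarC. Qed.

(** By [deg1_cube], [y] has the form [u ** t], and [b x (u ** t) = b (x ** u) t = 0]. *)
Lemma deg1_isotropic x y : deg1 u x -> deg1 u y -> b x y = 0.
Proof.
move=> [xu bx] dy; have := deg1_cube dy => /(congr1 (b x)).
rewrite -assoc xu polar0l polarNr polarZr => /esym/eqP.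
by rewrite oppr_eq0 mulf_eq0 (negPf gu) => /eqP.
Qed.

Lemma deg2_isotropic x y : deg2 u x -> deg2 u y -> b x y = 0.
Proof.
move=> [xu bx] dy; have := deg2_cube dy => /(congr1 (b^~ x)).
rewrite assoc xu polar0r polarNl polarZl polarC => /esym/eqP.
by rewrite oppr_eq0 mulf_eq0 (negPf gu) => /eqP.
Qed.

Lemma deg1_norm x : deg1 u x -> n x = 0.
Proof. by case=> xu _; apply: norm_left_annihilator. Qed.

Lemma deg1_mulC x y : deg1 u x -> deg1 u y -> x ** (u ** y) = - (y ** (u ** x)).
Proof. by move=> dx dy; rewrite swapr deg1_isotropic // scale0r sub0r. Qed.

Lemma deg1_mul_mull x y : deg1 u y -> (u ** x) ** y = - ((y ** x) ** u).
Proof. by case=> _ bx; rewrite swapl polarC bx scale0r sub0r. Qed.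

Lemma deg2_mulC x y : deg2 u x -> deg2 u y -> (x ** u) ** y = - ((y ** u) ** x).
Proof. by move=> dx dy; rewrite swapl deg2_isotropic // scale0r sub0r. Qed.

Lemma deg2_mul_mulr x y : deg2 u x -> x ** (y ** u) = - (u ** (y ** x)).
Proof. by case=> _ bx; rewrite swapr bx scale0r sub0r. Qed.

Lemma deg2_mul11 x y : deg1 u x -> deg1 u y -> deg2 u (x ** y).
Proof.
move=> [xu bx] [yu cy]; split; last by rewrite assoc yu polar0r.
by rewrite swapr polarC cy xu star0r scale0r subr0.
Qed.

Lemma deg2_mul_deg1 x y : deg2 u x -> deg1 u y -> x ** (u ** y) = b x y *: u.
Proof. by move=> [xu _] _; rewrite swapr xu star0r subr0. Qed.

(** The vectors [u] and [u ** u] are isotropic with mutual polar value alpha, which explains the two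
    coefficients. On their orthogonal complement the cubes of left and right multiplication by [u]
    add up to -alpha. *)
Lemma decomposition x : exists p q, [/\ deg1 u p, deg2 u q &
  x = (b x (u ** u) / alpha) *: u + (b x u / alpha) *: (u ** u) + p + q].
Proof.
set c := _ *: u; set d := _ *: (u ** u); pose y := x - c - d.
have gu' : b (u ** u) u = alpha by rewrite polarC.
have by0 : b y u = 0.
  by rewrite /y !(polarDl, polarNl, polarZl) buu mulr0 gu' subr0 divfK ?subrr.
have by1 : b y (u ** u) = 0.
  rewrite /y !(polarDl, polarNl, polarZl) -/(cubic u) divfK //.
  by rewrite (polar_diag norm_sqr) mulr0 subr0 subrr.
(* Up to the factor -1/alpha, the two cubes are the projections onto degrees 1 and 2. *)
exists (- alpha^-1 *: (u ** (u ** (u ** y)))), (- alpha^-1 *: (((y ** u) ** u) ** u)).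
split.
- by apply: deg1Z; split; rewrite ?uxu // polar_assoc // uxu polar0r.
- by apply: deg2Z; split; rewrite ?u_xu // polarC -assoc u_xu polar0l.
have -> : u ** (u ** (u ** y)) = - (alpha *: y) - y ** u ** u ** u.
  rewrite [u ** (u ** y)]swapr polarC by0 scale0r sub0r starNr swapr opprB.
  rewrite swapl -assoc [b (u ** y) u]polarC -[b u (u ** y)]assoc polarC by1.
  by rewrite scale0r sub0r addrC.
rewrite scaleNr -scalerN opprB opprK scalerDr scalerA mulVf // scale1r scaleNr.
rewrite [_ *: _ + y]addrC [c + d + _]addrA addrK.
by rewrite /y -[x - c - d]addrA -opprD addrC subrK.
Qed.

(** Degree 1 is orthogonal to [u], [u ** u] and itself, so only degree 2 can pair with it. *)
Lemma deg1_nondegenerate x : deg1 u x -> (forall y, deg2 u y -> b x y = 0) -> x = 0.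
Proof.
move=> dx x0; case: symA => _ _ _; apply=> y.
have [p [q [dp dq ->]]] := decomposition y; move: (_ / _) (_ / _) => c d.
rewrite !polarDr !polarZr -assoc dx.1 dx.2 polar0l (deg1_isotropic dx dp) x0 //.
by rewrite !mulr0 !addr0.
Qed.

Lemma deg2_nondegenerate x : deg2 u x -> (forall y, deg1 u y -> b y x = 0) -> x = 0.
Proof.
move=> dx x0; case: symA => _ _ _; apply=> y.
have [p [q [dp dq ->]]] := decomposition y; move: (_ / _) (_ / _) => c d.
rewrite !polarDr !polarZr [b x (u ** u)]polarC assoc dx.1 dx.2 polar0r.
by rewrite [b x p]polarC x0 // (deg2_isotropic dx dq) !mulr0 !addr0.
Qed.

(* For [z] of degree 2, [z * x] lies in the line of [u], because [x] is in the *)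
(* image of left multiplication by [u]; so [(z * x) * x = n(x, z) x] gives a   *)
(* linear relation between [x] and [u * x].                                    *)
Lemma deg1_sqr0_eigen x : deg1 u x -> x ** x = 0 -> exists a, u ** x = a *: x.
Proof.
move=> dx xx; have [->|x0] := eqVneq x 0; first by exists 0; rewrite star0r scaler0.
have [z [dz bxz]] : exists z, deg2 u z /\ b x z != 0.
  apply: NNPP => no; case/eqP: x0; apply: deg1_nondegenerate => // z dz.
  by apply/eqP/contraT => bxz; case: no; exists z.
have Ex : x = u ** ((- alpha^-1) *: (u ** (u ** x))).
  by rewrite mulZr deg1_cube // scalerN scaleNr opprK scalerA mulVf ?scale1r.
have := swapl x x z; rewrite xx star0l => /esym/eqP; rewrite subr_eq0 => /eqP.
rewrite {3}Ex deg2_mul_deg1 //; last by apply/deg1Z/deg1_mull/deg1_mull.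
set c := b z _; rewrite mulZl => E.
have c0 : c != 0.
  apply: contra_neq x0 => c0; move/eqP: E.
  by rewrite c0 scale0r scaler_eq0 (negPf bxz) => /eqP.
by exists (c^-1 * b x z); rewrite -scalerA E scalerA mulVf ?scale1r.
Qed.

(** A linear map for which every vector is an eigenvector is a scalar. *)
Lemma deg1_scalar : (forall x, deg1 u x -> x ** x = 0) ->
  exists a, forall x, deg1 u x -> u ** x = a *: x.
Proof.
move=> sq0; have eig x (dx : deg1 u x) := deg1_sqr0_eigen dx (sq0 x dx).
have [[x0 [dx0 x0_neq0]]|no] := classic (exists x0, deg1 u x0 /\ x0 != 0); last first.
  exists 0 => x dx; have [->|x0] := eqVneq x 0; first by rewrite star0r scale0r.
  by case: no; exists x.
have [a Ea] := eig _ dx0; exists a => y dy.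
have [c Ec] := eig _ dy; have [d] := eig _ (deg1D dx0 dy).
rewrite starDr Ea Ec scalerDr => E.
have {E} E : (a - d) *: x0 = (d - c) *: y.
  by rewrite !scalerBl; apply/eqP; rewrite subr_eq addrAC eq_sym subr_eq E addrC.
have [cd|cd] := eqVneq d c.
  move/eqP: E; rewrite cd subrr scale0r scaler_eq0 (negPf x0_neq0) orbF subr_eq0.
  by move/eqP->.
have Ey : y = ((d - c)^-1 * (a - d)) *: x0.
  by rewrite -scalerA E scalerA mulVf ?scale1r // subr_eq0.
by rewrite -Ec Ey mulZr Ea !scalerA [_ * a]mulrC.
Qed.

(** The element is [u ** u - a *: u]: in degrees 1 and 2 it acts as -a^2 from either side, and its
    polar value with [u] is alpha. *)
Lemma deg1_scalar_center a : (forall x, deg1 u x -> u ** x = a *: x) ->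
  exists2 e, e != 0 & forall y, e ** y = y ** e.
Proof.
move=> Ea; exists (u ** u - a *: u) => [|y].
  apply: contraNneq gu => e0; have := congr1 (b^~ u) e0.
  by rewrite /cubic polar0l polarDl polarNl polarZl buu mulr0 subr0 polarC => ->.
(* Right multiplication by [u] in degree 2 is adjoint to left multiplication in degree 1, hence the
   same scalar. *)
have Ea' w : deg2 u w -> w ** u = a *: w.
  move=> dw; apply/eqP; rewrite -subr_eq0; apply/eqP/deg2_nondegenerate => [|x dx].
    have [h1 h2] := deg2_mulr dw; case: dw => h3 h4.
    split; rewrite ?starDr ?starNr ?mulZr ?polarDl ?polarNl ?polarZl.
      by rewrite h1 h3 scaler0 subr0.
    by rewrite h2 h4 mulr0 subr0.
  by rewrite polarDr polarNr polarZr -polar_mul_adj Ea // polarZl subrr.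
have [p [q [dp dq ->]]] := decomposition y; move: (_ / _) (_ / _) => c d.
rewrite !(starDl, starDr, mulZl, mulZr, starNl, starNr) uxu u_xu sqr_sqr.
rewrite deg1_sqrl // deg1_sqrr // deg2_sqrl // deg2_sqrr // dp.1 dq.1 !(Ea p, Ea' q) //.
rewrite mulZr mulZl (Ea p) // (Ea' q) // !(scaler0, sub0r, subr0, addr0, oppr0, add0r).
rewrite !scalerDr -!addrA -!opprD; congr (_ - _).
by rewrite addrCA [RHS]addrCA [X in _ + X = _]addrC.
Qed.

End Decomposition.

(** Replacing [u] by [u ** u] lets facts about degree 1 apply to degree 2. *)
Lemma deg2_sqr u x : n u = 0 -> deg2 u x -> deg1 (u ** u) x.
Proof.
move=> nu dx; split; first exact: deg2_sqrr.
by rewrite polarC polar_assoc // dx.1 polar0r.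
Qed.

(** This excludes para-Hurwitz algebras, whose para-unit commutes with every element. *)
Definition trivial_center := forall e : A, (forall y, e ** y = y ** e) -> e = 0.

Hypothesis cA : trivial_center.

Lemma deg1_sqr_neq0 u : n u = 0 -> cubic u != 0 -> exists2 v, deg1 u v & v ** v != 0.
Proof.
move=> nu gu; apply: NNPP => no.
have [|a Ea] := deg1_scalar nu gu.
  by move=> x dx; apply/eqP/contraT => xx; case: no; exists x.
have [e e0 ce] := deg1_scalar_center nu gu Ea.
by rewrite (cA ce) eqxx in e0.
Qed.

Lemma exists_generators : isotropic_norm A -> exists u v : A,
  [/\ n u = 0, cubic u != 0, deg1 u v & cubic v != 0].
Proof.
move=> iA; apply: NNPP => no.
have {no} no u v : n u = 0 -> cubic u != 0 -> deg1 u v -> cubic v = 0.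
  by move=> nu gu uv; apply/eqP/contraT => gv; case: no; exists u, v.
have [u [nu gu]] := isotropic_cubic symA iA.
have [v dv /eqP[]] := deg1_sqr_neq0 nu gu.
have [char3|char3] := eqVneq (3%:R : F) 0; last first.
  (* Polarizing [cubic = 0] twice makes the product skew-symmetric in degree 1. *)
  have skew x y : deg1 u x -> deg1 u y -> x ** y = - (y ** x).
    move=> dx dy; apply/eqP; rewrite -subr_eq0 opprK; apply/eqP.
    have H s t : deg1 u s -> deg1 u t -> b (s ** s) t + b s (t ** t) = 0.
      move=> ds dt; have := cubicD symA s t.
      rewrite (no u s) // (no u t) // (no u (s + t)) //; last exact: deg1D.
      rewrite add0r addr0 -mulrDr => /esym/eqP.
      by rewrite mulf_eq0 (negPf char3) => /eqP.
    apply: (deg2_nondegenerate nu gu) => [|z dz].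
      have [h1 h2] := deg2_mul11 dx dy; have [h3 h4] := deg2_mul11 dy dx.
      by split; rewrite ?starDr ?polarDl ?h1 ?h2 ?h3 ?h4 addr0.
    have := H _ _ (deg1D dx dy) dz.
    rewrite !(starDl, starDr, polarDl) => E; rewrite polarC polarDl -E.
    apply/eqP; rewrite -subr_eq0; apply/eqP.
    transitivity (- (b (x ** x) z + b x (z ** z)) - (b (y ** y) z + b y (z ** z))).
      by ring.
    by rewrite !H // oppr0 addr0.
  (* Up to sign this is [(u ** v) ** v], which skew-symmetry turns into
     [v ** (u ** v) = n v *: u]. *)
  have vv : (v ** v) ** u = 0.
    apply/eqP; rewrite -oppr_eq0 -deg1_mul_mull // skew //; last exact: deg1_mull.
    by case: symA => _ -> _ _; rewrite (deg1_norm gu dv) scale0r oppr0.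
  have := deg2_cube (deg2_mul11 dv dv).
  rewrite vv !star0l => /esym/eqP.
  by rewrite oppr_eq0 scaler_eq0 (negPf gu) => /eqP.
(* In characteristic 3 [cubic] is additive. The element [u + v] also satisfies *)
(* the assumptions on [u]; comparing the two decompositions yields [v * v = 0]. *)
have cD x y : cubic (x + y) = cubic x + cubic y.
  by rewrite cubicD // char3 !mul0r !addr0.
have nuv : n (u + v) = 0 by rewrite normD nu (deg1_norm gu dv) polarC dv.2 !addr0.
have guv : cubic (u + v) != 0 by rewrite cD (no u v) ?addr0.
apply: (deg2_nondegenerate nu gu (deg2_mul11 dv dv)) => p dp.
(* The scalar [a] makes [x] orthogonal to [(u + v) ** (u + v)]. Then [x] is a sum of parts of
   degrees 1 and 2 for [u + v], so [cubic x = 0], which forces [a = 0]. *)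
pose a := - b p (v ** v) / cubic u; pose x := p + a *: u.
have buu : b u u = 0 by apply: polar_diag.
have xuv : b x (u + v) = 0.
  rewrite !(polarDl, polarDr, polarZl) dp.2 (deg1_isotropic gu dp dv).
  by rewrite buu polarC dv.2 mulr0 !addr0.
have xuvuv : b x ((u + v) ** (u + v)) = 0.
  have pu y : b p (u ** y) = 0 by rewrite -polar_assoc // dp.1 polar0l.
  have uuv : b u (u ** v) = 0.
    by rewrite -polar_assoc // polarC -polar_assoc // dv.1 polar0l.
  have uvv : b u (v ** v) = 0.
    by rewrite -polar_assoc // polarC -polar_assoc // dv.1 polar0l.
  rewrite !(starDl, starDr) dv.1 add0r !(polarDl, polarDr, polarZl) !pu uuv uvv.
  by rewrite !(addr0, add0r, mulr0) -/(cubic u) /a divfK // addNr.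
have [p' [q' [dp' dq' Ex]]] := decomposition nuv guv x.
have : cubic x = a ^+ 3 * cubic u by rewrite cD cubicZ (no u p) ?add0r.
rewrite Ex xuv xuvuv !mul0r !scale0r !add0r cD (no (u + v)) // add0r.
rewrite (no ((u + v) ** (u + v))) ?norm_sqr ?cubic_sqr ?expf_neq0 //; last first.
  exact: deg2_sqr.
move/esym/eqP; rewrite mulf_eq0 (negPf gu) orbF expf_eq0 /=.
by rewrite mulf_eq0 invr_eq0 (negPf gu) orbF oppr_eq0 => /eqP.
Qed.

End IsotropicElement.

(** * The multiplication table of two generators *)

Section Generators.
Variables (F : fieldType) (A : normed_algebra F).
Hypothesis symA : symmetric_composition A.
Implicit Types (x y z : A).
Local Notation b := (polar norm_of).
Local Notation n := norm_of.
Variables u v : A.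
Hypotheses (nu : n u = 0) (gu : cubic u != 0) (dv : deg1 u v) (gv : cubic v != 0).
Local Notation alpha := (cubic u).
Local Notation beta := (cubic v).

(* The signs come from [z_(1,0) * z_(i,1) = - z_(i+1,1)] and                   *)
(* [z_(i,2) * z_(1,0) = - z_(i+1,2)].                                          *)
Definition okubo_basis (p : 'Z_3 * 'Z_3) : A :=
  match (p.1 : nat), (p.2 : nat) with
  | 1%N, 0%N => u
  | 2%N, 0%N => u ** u
  | 0%N, 1%N => v
  | 1%N, 1%N => - (u ** v)
  | 2%N, 1%N => u ** (u ** v)
  | 0%N, 2%N => v ** v
  | 1%N, 2%N => - (v ** v ** u)
  | 2%N, 2%N => v ** v ** u ** u
  | _, _ => 0
  end.

Let x1 := u ** v.
Let x2 := u ** x1.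
Let w := v ** v.
Let w1 := w ** u.
Let w2 := w1 ** u.

Let xyx x y : n x = 0 -> (x ** y) ** x = 0.
Proof. by case: symA => -> _ _ _ ->; rewrite scale0r. Qed.
Let x_yx x y : n x = 0 -> x ** (y ** x) = 0.
Proof. by case: symA => _ -> _ _ ->; rewrite scale0r. Qed.

Let dx1 : deg1 u x1. Proof. exact: deg1_mull. Qed.
Let dx2 : deg1 u x2. Proof. exact: deg1_mull. Qed.
Let dw : deg2 u w. Proof. exact: deg2_mul11. Qed.
Let dw1 : deg2 u w1. Proof. exact: deg2_mulr. Qed.
Let dw2 : deg2 u w2. Proof. exact: deg2_mulr. Qed.
Let nv : n v = 0. Proof. exact: (deg1_norm symA gu). Qed.
Let nx1 : n x1 = 0. Proof. exact: (deg1_norm symA gu). Qed.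
Let nw : n w = 0. Proof. exact: (norm_right_annihilator symA gu dw.1). Qed.
Let nw1 : n w1 = 0. Proof. exact: (norm_right_annihilator symA gu dw1.1). Qed.

Let ux2 : u ** x2 = - (alpha *: v). Proof. exact: deg1_cube. Qed.
Let w2u : w2 ** u = - (alpha *: w). Proof. exact: deg2_cube. Qed.

Let uuu : u ** u ** u = 0. Proof. exact: xyx. Qed.
Let u_uu : u ** (u ** u) = 0. Proof. exact: x_yx. Qed.
Let uuuu : (u ** u) ** (u ** u) = alpha *: u. Proof. exact: sqr_sqr. Qed.
Let s1v : u ** u ** v = 0. Proof. exact: deg1_sqrl. Qed.
Let s1x1 : u ** u ** x1 = 0. Proof. exact: deg1_sqrl. Qed.
Let s1x2 : u ** u ** x2 = 0. Proof. exact: deg1_sqrl. Qed.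
Let s1w : u ** u ** w = - w2. Proof. exact: deg2_sqrl. Qed.
Let s1w1 : u ** u ** w1 = alpha *: w.
Proof. by rewrite (deg2_sqrl symA) // -/w2 w2u opprK. Qed.
Let s1w2 : u ** u ** w2 = alpha *: w1.
Proof. by rewrite (deg2_sqrl symA) // w2u starNl mulZl opprK. Qed.
Let s2v : v ** (u ** u) = - x2. Proof. exact: deg1_sqrr. Qed.
Let s2x1 : x1 ** (u ** u) = alpha *: v.
Proof. by rewrite (deg1_sqrr symA) // -/x2 ux2 opprK. Qed.
Let s2x2 : x2 ** (u ** u) = alpha *: x1.
Proof. by rewrite (deg1_sqrr symA) // ux2 starNr mulZr opprK. Qed.
Let s2w : w ** (u ** u) = 0. Proof. exact: deg2_sqrr. Qed.
Let s2w1 : w1 ** (u ** u) = 0. Proof. exact: deg2_sqrr. Qed.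
Let s2w2 : w2 ** (u ** u) = 0. Proof. exact: deg2_sqrr. Qed.

(** In degree 1, [(u ** x) ** y = - ((y ** x) ** u)] reduces products to [v ** v] and to products
    killed by isotropy; degree 2 is treated symmetrically. *)
Let vx1 : v ** x1 = 0. Proof. exact: x_yx. Qed.
Let x1v : x1 ** v = - w1. Proof. exact: deg1_mul_mull. Qed.
Let x1x1 : x1 ** x1 = w2.
Proof. by rewrite {1}/x1 (deg1_mul_mull symA) // x1v starNl opprK. Qed.
Let vx2 : v ** x2 = - w2.
Proof. by rewrite (deg1_mulC symA gu) // -/x1 x1x1. Qed.
Let x2v : x2 ** v = 0.
Proof. by rewrite (deg1_mul_mull symA) // vx1 star0l oppr0. Qed.
Let x1x2 : x1 ** x2 = 0. Proof. exact: x_yx. Qed.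
Let x2x1 : x2 ** x1 = alpha *: w.
Proof. by rewrite {1}/x2 (deg1_mul_mull symA) // x1x1 w2u opprK. Qed.
Let x2x2 : x2 ** x2 = - (alpha *: w1).
Proof. by rewrite {1}/x2 (deg1_mul_mull symA) // x2x1 mulZl. Qed.

Let ww : w ** w = beta *: v.
Proof. exact: sqr_sqr. Qed.
Let w1w : w1 ** w = 0. Proof. exact: xyx. Qed.
Let ww1 : w ** w1 = - (beta *: x1).
Proof. by rewrite (deg2_mul_mulr symA) // ww mulZr. Qed.
Let w1w1 : w1 ** w1 = beta *: x2.
Proof. by rewrite {2}/w1 (deg2_mul_mulr symA) // ww1 starNr mulZr opprK. Qed.
Let w2w : w2 ** w = - (beta *: x2).
Proof. by rewrite (deg2_mulC symA gu) // -/w1 w1w1. Qed.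
Let ww2 : w ** w2 = 0.
Proof. by rewrite (deg2_mul_mulr symA) // w1w star0r oppr0. Qed.
Let w1w2 : w1 ** w2 = (alpha * beta) *: v.
Proof.
by rewrite (deg2_mul_mulr symA) // w1w1 mulZr ux2 scalerN opprK scalerA mulrC.
Qed.
Let w2w1 : w2 ** w1 = 0. Proof. exact: xyx. Qed.
Let w2w2 : w2 ** w2 = - ((alpha * beta) *: x1).
Proof. by rewrite {2}/w2 (deg2_mul_mulr symA) // w1w2 mulZr. Qed.

Let bvw : b v w = beta. Proof. by []. Qed.
Let bx1w : b x1 w = 0. Proof. by rewrite polar_assoc // x_yx // polar0r. Qed.
Let bx1w1 : b x1 w1 = 0.
Proof.
by rewrite -[w1]opprK -x1v polarNr polarC polar_cycle // vx1 polar0l oppr0.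
Qed.
Let adj y z : b (u ** y) z = b y (z ** u).
Proof. exact: polar_mul_adj. Qed.
Let bvw1 : b v w1 = 0. Proof. by rewrite -adj. Qed.
Let bx2w : b x2 w = 0. Proof. by rewrite adj. Qed.
Let bx1w2 : b x1 w2 = - (alpha * beta).
Proof. by rewrite adj w2u polarNr polarZr. Qed.
Let bx2w1 : b x2 w1 = - (alpha * beta).
Proof. by rewrite adj. Qed.

(** Degree 2 times degree 1 lies in the line of [u], with a polar value as coefficient. The opposite
    order reduces to it and gives multiples of [u ** u]. *)
Let deg2_mulu_deg1 z x : deg1 u x -> z ** u ** x = b x z *: u.
Proof. by case=> xu _; rewrite mul_swapl // xu star0l subr0 polarC. Qed.
Let wv : w ** v = 0. Proof. exact: xyx. Qed.
Let wx1 : w ** x1 = beta *: u.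
Proof. by rewrite (deg2_mul_deg1 symA) // polarC. Qed.
Let wx2 : w ** x2 = 0.
Proof. by rewrite (deg2_mul_deg1 symA) // polarC bx1w scale0r. Qed.
Let w1v : w1 ** v = beta *: u. Proof. by rewrite deg2_mulu_deg1. Qed.
Let w1x1 : w1 ** x1 = 0.
Proof. by rewrite deg2_mulu_deg1 // bx1w scale0r. Qed.
Let w1x2 : w1 ** x2 = 0.
Proof. by rewrite deg2_mulu_deg1 // bx2w scale0r. Qed.
Let w2v : w2 ** v = 0.
Proof. by rewrite deg2_mulu_deg1 // bvw1 scale0r. Qed.
Let w2x1 : w2 ** x1 = 0.
Proof. by rewrite deg2_mulu_deg1 // bx1w1 scale0r. Qed.
Let w2x2 : w2 ** x2 = - ((alpha * beta) *: u).
Proof. by rewrite deg2_mulu_deg1 // bx2w1 scaleNr. Qed.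

Let deg1_mul_mulu z x : deg1 u x -> x ** (z ** u) = - (u ** (z ** x)).
Proof. by case=> _ bx; rewrite mul_swapr // bx scale0r sub0r. Qed.
Let mulu_mul_deg2 z x : deg2 u z -> u ** x ** z = - ((z ** x) ** u).
Proof. by case=> _ bx; rewrite mul_swapl // polarC bx scale0r sub0r. Qed.
Let vw : v ** w = 0. Proof. exact: x_yx. Qed.
Let vw1 : v ** w1 = 0. Proof. by rewrite deg1_mul_mulu // wv star0r oppr0. Qed.
Let vw2 : v ** w2 = - (beta *: (u ** u)).
Proof. by rewrite deg1_mul_mulu // w1v mulZr. Qed.
Let x1w : x1 ** w = 0.
Proof. by rewrite mulu_mul_deg2 // wv star0l oppr0. Qed.
Let x1w1 : x1 ** w1 = - (beta *: (u ** u)).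
Proof. by rewrite deg1_mul_mulu // wx1 mulZr. Qed.
Let x1w2 : x1 ** w2 = 0.
Proof. by rewrite deg1_mul_mulu // w1x1 star0r oppr0. Qed.
Let x2w : x2 ** w = - (beta *: (u ** u)).
Proof. by rewrite mulu_mul_deg2 // wx1 mulZl. Qed.
Let x2w1 : x2 ** w1 = 0.
Proof. by rewrite deg1_mul_mulu // wx2 star0r oppr0. Qed.
Let x2w2 : x2 ** w2 = 0.
Proof. by rewrite deg1_mul_mulu // w1x2 star0r oppr0. Qed.

Let vu : v ** u = 0. Proof. exact: dv.1. Qed.
Let x1u : x1 ** u = 0. Proof. exact: dx1.1. Qed.
Let x2u : x2 ** u = 0. Proof. exact: dx2.1. Qed.
Let uw : u ** w = 0. Proof. exact: dw.1. Qed.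
Let uw1 : u ** w1 = 0. Proof. exact: dw1.1. Qed.
Let uw2 : u ** w2 = 0. Proof. exact: dw2.1. Qed.

Let uE := (uuu, u_uu, uuuu, s1v, s1x1, s1x2, s1w, s1w1, s1w2, s2v, s2x1, s2x2,
  s2w, s2w1, s2w2, ux2, w2u, vu, x1u, x2u, uw, uw1, uw2).
Let v1E := (vx1, x1v, x1x1, vx2, x2v, x1x2, x2x1, x2x2, vw, vw1, vw2,
  x1w, x1w1, x1w2, x2w, x2w1, x2w2).
Let v2E := (ww, w1w, ww1, w1w1, w2w, ww2, w1w2, w2w1, w2w2,
  wv, wx1, wx2, w1v, w1x1, w1x2, w2v, w2x1, w2x2).

Let div3E : ((0 + 0) %/ 3 = 0)%N * ((0 + 1) %/ 3 = 0)%N * ((0 + 2) %/ 3 = 0)%N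
  * ((1 + 0) %/ 3 = 0)%N * ((1 + 1) %/ 3 = 0)%N * ((1 + 2) %/ 3 = 1)%N
  * ((2 + 0) %/ 3 = 0)%N * ((2 + 1) %/ 3 = 1)%N * ((2 + 2) %/ 3 = 1)%N.
Proof. by []. Qed.

(** A check of 64 products against the table; [div3E] evaluates the carries in the exponents of
    alpha and beta. *)
Lemma okubo_basis_mul p r : p != 0 -> r != 0 ->
  okubo_basis p ** okubo_basis r
  = (okubo_eps F p r * okubo_coef alpha beta p r) *: okubo_basis (p + r).
Proof.
case: p r => [[[|[|[|//]]] ?] [[|[|[|//]]] ?]] [[[|[|[|//]]] ?] [[|[|[|//]]] ?]].
all: move=> // _; move=> // _.
all: rewrite /okubo_basis /okubo_eps /okubo_coef /= ?star0l ?star0r ?scaler0 //.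
all: rewrite -/x1 -/x2 -/w -/w1 -/w2 ?starNl ?starNr ?(uE, v1E, v2E) ?div3E.
all: rewrite ?(expr0, expr1, mulr1, mul1r, mulN1r, mul0r, scale0r, scaleNr, scalerN).
all: rewrite ?opprK ?oppr0 ?scale1r //.
Qed.
End Generators.

(** * The split Okubo algebra *)

(** An identity quadratic in [x] passes to sums once its polarization is known, so basis vectors
    suffice. *)
Lemma mulxyxD (F : fieldType) (A : normed_algebra F) (x x' y : A) :
  x ** y ** x' + x' ** y ** x = polar norm_of x x' *: y ->
  x ** y ** x = norm_of x *: y -> x' ** y ** x' = norm_of x' *: y ->
  (x + x') ** y ** (x + x') = norm_of (x + x') *: y.
Proof.
move=> E Ex Ex'; rewrite !(starDl, starDr) Ex Ex' normD scalerDl scalerDl -E.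
by rewrite [x ** y ** x' + _]addrC addrACA [X in _ + X = _]addrC.
Qed.

Lemma mulx_yxD (F : fieldType) (A : normed_algebra F) (x x' y : A) :
  x ** (y ** x') + x' ** (y ** x) = polar norm_of x x' *: y ->
  x ** (y ** x) = norm_of x *: y -> x' ** (y ** x') = norm_of x' *: y ->
  (x + x') ** (y ** (x + x')) = norm_of (x + x') *: y.
Proof.
move=> E Ex Ex'; rewrite !(starDl, starDr) Ex Ex' normD scalerDl scalerDl -E.
by rewrite [x' ** (y ** x) + _]addrC addrACA.
Qed.

Section SplitSymmetric.
Variable K : fieldType.
Local Notation S := (split_okubo K).
Local Notation b := (polar (@norm_of K S)).
Local Notation Z p := (okubo_z K p : S).

Definition Z3_pairs : seq ('Z_3 * 'Z_3) :=
  [seq (i, j) | i <- [:: 0; 1; 1 + 1], j <- [:: 0; 1; 1 + 1]].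

Lemma mem_Z3_pairs p : p \in Z3_pairs.
Proof. by case: p => [[[|[|[|//]]] ?] [[|[|[|//]]] ?]]. Qed.

(** Integer signs let identities be decided by computation once, for every field. *)
Definition eps_int (p r : 'Z_3 * 'Z_3) : int :=
  if (okubo_delta p r == 2) || (p + r == 0) then 0
  else if okubo_delta p r == 1 then -1 else 1.

Lemma eps_intE p r : okubo_eps K p r = (eps_int p r)%:~R.
Proof. by rewrite /okubo_eps /eps_int; do 2?case: ifP; rewrite ?mulrNz. Qed.

Lemma eps_int_opposite p r : p + r = 0 -> eps_int p r = 0.
Proof. by move=> pr; rewrite /eps_int pr eqxx orbT. Qed.

(** The linearized composition identities for structure constants. The case [p + q + r = 0] is
    excluded because the products are then multiples of [okubo_z 0], which is 0. *)
Lemma eps_int_swap p q r : p != 0 -> q != 0 -> r != 0 -> p + q + r != 0 ->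
  eps_int p q * eps_int (p + q) r + eps_int r q * eps_int (r + q) p
    = (p + r == 0)%:R
  /\ eps_int q r * eps_int p (q + r) + eps_int q p * eps_int r (q + p)
    = (p + r == 0)%:R.
Proof.
suff : all (fun p => all (fun q => all (fun r =>
    [==> p != 0, q != 0, r != 0, p + q + r != 0 =>
     (eps_int p q * eps_int (p + q) r + eps_int r q * eps_int (r + q) p
      == (p + r == 0)%:R)
     && (eps_int q r * eps_int p (q + r) + eps_int q p * eps_int r (q + p)
      == (p + r == 0)%:R)]) Z3_pairs) Z3_pairs) Z3_pairs.
  move=> /allP/(_ p (mem_Z3_pairs p))/allP/(_ q (mem_Z3_pairs q)).
  move=> /allP/(_ r (mem_Z3_pairs r)) H p0 q0 r0 s0.
  by move: H; rewrite p0 q0 r0 s0 => /andP[/eqP-> /eqP->].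
by vm_compute.
Qed.

Lemma eps_int_diag p q : p != 0 -> q != 0 -> p + q + p != 0 ->
  eps_int p q * eps_int (p + q) p = 0 /\ eps_int q p * eps_int p (q + p) = 0.
Proof.
suff : all (fun p => all (fun q => [==> p != 0, q != 0, p + q + p != 0 =>
     (eps_int p q * eps_int (p + q) p == 0)
     && (eps_int q p * eps_int p (q + p) == 0)]) Z3_pairs) Z3_pairs.
  move=> /allP/(_ p (mem_Z3_pairs p))/allP/(_ q (mem_Z3_pairs q)) H p0 q0 s0.
  by move: H; rewrite p0 q0 s0 => /andP[/eqP-> /eqP->].
by vm_compute.
Qed.

Lemma eps_int_cycle p q r : p != 0 -> q != 0 -> r != 0 -> p + q + r = 0 ->
  eps_int p q = eps_int q r.
Proof.
suff : all (fun p => all (fun q => all (fun r =>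
    [==> p != 0, q != 0, r != 0, p + q + r == 0 => eps_int p q == eps_int q r])
    Z3_pairs) Z3_pairs) Z3_pairs.
  move=> /allP/(_ p (mem_Z3_pairs p))/allP/(_ q (mem_Z3_pairs q)).
  move=> /allP/(_ r (mem_Z3_pairs r)) H p0 q0 r0 /eqP s0.
  by move: H; rewrite p0 q0 r0 s0 => /eqP.
by vm_compute.
Qed.


Lemma eps_int_noncentral p : p != 0 -> exists r s,
  [/\ r != 0, s != 0, p + (r + s) = 0, eps_int r s = -1 & eps_int s r = 0].
Proof.
move=> p0.
suff : all (fun p => (p != 0) ==> has (fun r => has (fun s =>
    [&& r != 0, s != 0, p + (r + s) == 0, eps_int r s == -1 & eps_int s r == 0])
    Z3_pairs) Z3_pairs) Z3_pairs.
  move=> /allP/(_ p (mem_Z3_pairs p)); rewrite p0 => /hasP[r _ /hasP[s _]].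
  by case/and5P=> r0 s0 /eqP E /eqP e1 /eqP e2; exists r, s.
by vm_compute.
Qed.

Lemma okubo_z0 : okubo_z K 0 = 0.
Proof. by apply/ffunP => r; rewrite !ffunE (negPf (valP r)). Qed.

Lemma split_mul p r : p != 0 -> r != 0 -> Z p ** Z r = (eps_int p r)%:~R *: Z (p + r).
Proof. by move=> p0 r0; rewrite split_okubo_mul // eps_intE. Qed.

Lemma split_mul3l p q r : p != 0 -> q != 0 -> r != 0 ->
  Z p ** Z q ** Z r = (eps_int p q * eps_int (p + q) r)%:~R *: Z (p + q + r).
Proof.
move=> p0 q0 r0; rewrite split_mul // mulZl.
have [pq|pq] := eqVneq (p + q) 0.
  by rewrite (eps_int_opposite pq) mul0r !scale0r.
by rewrite split_mul // scalerA -intrM.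
Qed.

Lemma split_mul3r p q r : p != 0 -> q != 0 -> r != 0 ->
  Z p ** (Z q ** Z r) = (eps_int q r * eps_int p (q + r))%:~R *: Z (p + q + r).
Proof.
move=> p0 q0 r0; rewrite split_mul // mulZr.
have [qr|qr] := eqVneq (q + r) 0.
  by rewrite (eps_int_opposite qr) mul0r !scale0r.
by rewrite split_mul // scalerA -intrM addrA.
Qed.

Lemma split_expand (x : S) : x = \sum_p x p *: (Z (val p)).
Proof.
apply/ffunP => r; rewrite sum_ffunE (bigD1 r) //= big1 => [|p pr]; rewrite !ffunE.
  by rewrite eqxx addr0 [RHS]mulr1.
by rewrite val_eqE eq_sym (negPf pr) [LHS]mulr0.
Qed.

Lemma split_ind (P : S -> Prop) :
  P 0 -> (forall x y, P x -> P y -> P (x + y)) ->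
  (forall a p, p != 0 -> P (a *: Z p)) -> forall x, P x.
Proof.
move=> P0 PD PZ x; rewrite [x]split_expand; apply: big_ind => // p _.
exact/PZ/(valP p).
Qed.

Lemma split_swap p q r : p != 0 -> q != 0 -> r != 0 ->
  Z p ** Z q ** Z r + Z r ** Z q ** Z p = b (Z p) (Z r) *: Z q
  /\ Z p ** (Z q ** Z r) + Z r ** (Z q ** Z p) = b (Z p) (Z r) *: Z q.
Proof.
move=> p0 q0 r0; rewrite !split_mul3l // !split_mul3r // split_okubo_polar //.
have -> : r + q + p = p + q + r by rewrite -addrA [LHS]addrC [q + p]addrC.
rewrite -!scalerDl -!intrD.
have [s0|s0] := eqVneq (p + q + r) 0.
  have pr : (p + r == 0) = false.
    by apply: contraNF q0 => /eqP pr; rewrite -s0 addrAC pr add0r.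
  by rewrite s0 pr okubo_z0 !scaler0 scale0r.
have [-> ->] := eps_int_swap p0 q0 r0 s0.
case: eqP => [pr|_]; last by rewrite !scale0r.
by rewrite addrAC pr add0r !scale1r.
Qed.

Lemma split_diag p q : p != 0 -> q != 0 ->
  Z p ** Z q ** Z p = 0 /\ Z p ** (Z q ** Z p) = 0.
Proof.
move=> p0 q0; rewrite split_mul3l // split_mul3r //.
have [s0|s0] := eqVneq (p + q + p) 0; first by rewrite s0 okubo_z0 !scaler0.
by have [-> ->] := eps_int_diag p0 q0 s0; rewrite !scale0r.
Qed.

Lemma split_swapl (x y z : S) : x ** y ** z + z ** y ** x = b x z *: y.
Proof.
move: x; apply: split_ind => [|x x' Ex Ex'|a p p0].
- by rewrite !(star0l, star0r) polar0l scale0r addr0.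
- by rewrite !(starDl, starDr) polarDl scalerDl addrACA Ex Ex'.
move: y; apply: split_ind => [|y y' Ey Ey'|c q q0].
- by rewrite !(star0l, star0r) scaler0 addr0.
- by rewrite !(starDl, starDr) scalerDr addrACA Ey Ey'.
move: z; apply: split_ind => [|z z' Ez Ez'|d r r0].
- by rewrite !(star0l, star0r) polar0r scale0r addr0.
- by rewrite !(starDl, starDr) polarDr scalerDl addrACA Ez Ez'.
have [E _] := split_swap p0 q0 r0.
have -> : b (a *: Z p) (d *: Z r) *: (c *: Z q) = (a * c * d) *: (b (Z p) (Z r) *: Z q).
  by rewrite polarZ !scalerA; congr (_ *: _); ring.
by rewrite -E scalerDr !(mulZl, mulZr) !scalerA; congr (_ *: _ + _ *: _); ring.
Qed.

Lemma split_swapr (x y z : S) : x ** (y ** z) + z ** (y ** x) = b x z *: y.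
Proof.
move: x; apply: split_ind => [|x x' Ex Ex'|a p p0].
- by rewrite !(star0l, star0r) polar0l scale0r addr0.
- by rewrite !(starDl, starDr) polarDl scalerDl addrACA Ex Ex'.
move: y; apply: split_ind => [|y y' Ey Ey'|c q q0].
- by rewrite !(star0l, star0r) scaler0 addr0.
- by rewrite !(starDl, starDr) scalerDr addrACA Ey Ey'.
move: z; apply: split_ind => [|z z' Ez Ez'|d r r0].
- by rewrite !(star0l, star0r) polar0r scale0r addr0.
- by rewrite !(starDl, starDr) polarDr scalerDl addrACA Ez Ez'.
have [_ E] := split_swap p0 q0 r0.
have -> : b (a *: Z p) (d *: Z r) *: (c *: Z q) = (a * c * d) *: (b (Z p) (Z r) *: Z q).
  by rewrite polarZ !scalerA; congr (_ *: _); ring.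
by rewrite -E scalerDr !(mulZl, mulZr) !scalerA; congr (_ *: _ + _ *: _); ring.
Qed.

Lemma split_mulxyx (x y : S) : x ** y ** x = norm_of x *: y.
Proof.
move: x; apply: split_ind => [|x x' Ex Ex'|a p p0].
- by rewrite star0l norm0 scale0r star0l.
- by rewrite mulxyxD // split_swapl.
rewrite normZ split_okubo_norm // mulr0 scale0r.
move: y; apply: split_ind => [|y y' Ey Ey'|c q q0].
- by rewrite !(star0l, star0r).
- by rewrite !(starDl, starDr) Ey Ey' addr0.
by rewrite !(mulZl, mulZr) (split_diag p0 q0).1 !scaler0.
Qed.

Lemma split_mulx_yx (x y : S) : x ** (y ** x) = norm_of x *: y.
Proof.
move: x; apply: split_ind => [|x x' Ex Ex'|a p p0].
- by rewrite star0l norm0 scale0r.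
- by rewrite mulx_yxD // split_swapr.
rewrite normZ split_okubo_norm // mulr0 scale0r.
move: y; apply: split_ind => [|y y' Ey Ey'|c q q0].
- by rewrite !(star0l, star0r).
- by rewrite !(starDl, starDr) Ey Ey' addr0.
by rewrite !(mulZl, mulZr) (split_diag p0 q0).2 !scaler0.
Qed.

Lemma split_assoc_basis p q r : p != 0 -> q != 0 -> r != 0 ->
  b (Z p ** Z q) (Z r) = (eps_int p q)%:~R * (p + q + r == 0)%:R.
Proof.
move=> p0 q0 r0; rewrite split_mul // polarZl.
have [pq|pq] := eqVneq (p + q) 0; first by rewrite eps_int_opposite // !mul0r.
by rewrite split_okubo_polar.
Qed.

Lemma split_polar_assoc (x y z : S) : b (x ** y) z = b x (y ** z).
Proof.
move: x; apply: split_ind => [|x x' Ex Ex'|a p p0].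
- by rewrite star0l !polar0l.
- by rewrite starDl !polarDl Ex Ex'.
move: y; apply: split_ind => [|y y' Ey Ey'|c q q0].
- by rewrite star0l star0r polar0l polar0r.
- by rewrite starDl starDr polarDr polarDl Ey Ey'.
move: z; apply: split_ind => [|z z' Ez Ez'|d r r0].
- by rewrite star0r !polar0r.
- by rewrite starDr !polarDr Ez Ez'.
rewrite !(mulZl, mulZr) !(polarZl, polarZr) split_assoc_basis // polarC.
rewrite split_assoc_basis // [q + r + p]addrC addrA.
case: eqP => [s0|_]; last by rewrite !mulr0.
by rewrite -(eps_int_cycle p0 q0 r0 s0); ring.
Qed.

Lemma split_symmetric : symmetric_composition S.
Proof.
split; [exact: split_mulxyx | exact: split_mulx_yx | exact: split_polar_assoc |].
move=> x x0; apply/ffunP => p; rewrite ffunE.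
have := x0 (Z (- val p)); rewrite {1}[x]split_expand polar_suml (bigD1 p) //.
rewrite polarZl split_okubo_polar ?oppr_eq0 ?(valP p) // subrr eqxx mulr1.
rewrite big1 => [|r /andP[_ rp]]; first by rewrite /= addr0.
rewrite polarZl split_okubo_polar ?oppr_eq0 ?(valP p) ?(valP r) //.
by rewrite subr_eq0 val_eqE (negPf rp) mulr0.
Qed.

(** By associativity of the polar form, [e] is orthogonal to commutators, and every basis vector is,
    up to sign, a product whose reverse vanishes. *)
Lemma split_trivial_center : trivial_center S.
Proof.
move=> e ce; case: split_symmetric => _ _ _; apply.
apply: split_ind => [|y y' Ey Ey'|a p p0]; first exact: polar0r.
  by rewrite polarDr Ey Ey' addr0.
have [|r [s [r0 s0 prs rs sr]]] := @eps_int_noncentral (- p); first by rewrite oppr_eq0.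
have {prs} prs : r + s = p by apply/eqP; rewrite -subr_eq0 addrC prs.
have : b e (Z r ** Z s) = b e (Z s ** Z r).
  by rewrite -split_polar_assoc ce split_polar_assoc polarC split_polar_assoc.
rewrite !split_mul // rs sr scale0r polar0r prs polarZr mulrNz mulN1r.
by move/eqP; rewrite oppr_eq0 polarZr => /eqP->; rewrite mulr0.
Qed.

End SplitSymmetric.

(** * Descent and the equivalences *)

Section Transfer.
Variables (F K : fieldType) (iota : {rmorphism F -> K}).
Variables (A : normed_algebra F) (B : normed_algebra K) (psi : A -> B).
Hypotheses (psiP : forall a x y, psi (a *: x + y) = iota a *: psi x + psi y)
  (psiM : forall x y, psi (x ** y) = psi x ** psi y)
  (psi_norm : forall x, norm_of (psi x) = iota (norm_of x))
  (psi_inj : injective psi)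
  (psi_ind : forall P : B -> Prop,
     (forall c x, P (c *: psi x)) -> (forall y z, P y -> P z -> P (y + z)) ->
     forall y, P y).

Let psiD x y : psi (x + y) = psi x + psi y.
Proof. by rewrite -[x]scale1r psiP rmorph1 !scale1r. Qed.

Let psi0 : psi 0 = 0.
Proof. by have := psiD 0 0; rewrite addr0 -{1}[psi 0]addr0 => /addrI. Qed.

Let psiZ a x : psi (a *: x) = iota a *: psi x.
Proof. by rewrite -[a *: x]addr0 psiP psi0 addr0. Qed.

Let psi_polar x y : polar norm_of (psi x) (psi y) = iota (polar norm_of x y).
Proof. by rewrite /polar -psiD !psi_norm !rmorphB. Qed.

(** Identities are pulled back by injectivity. Nondegeneracy needs the image of [psi] to span [B],
    which [psi_ind] expresses as an induction principle. *)
Lemma symmetric_composition_transfer :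
  symmetric_composition B -> symmetric_composition A.
Proof.
case=> xyx x_yx assoc nondeg; split=> [x y|x y|x y z|x x0].
- by apply: psi_inj; rewrite !psiM psiZ xyx psi_norm.
- by apply: psi_inj; rewrite !psiM psiZ x_yx psi_norm.
- by apply: (fmorph_inj iota); rewrite -!psi_polar !psiM assoc.
apply: psi_inj; rewrite psi0; apply: nondeg; apply: psi_ind => [c y|y z Ey Ez].
  by rewrite polarZr psi_polar x0 rmorph0 mulr0.
by rewrite polarDr Ey Ez addr0.
Qed.

Lemma trivial_center_transfer : trivial_center B -> trivial_center A.
Proof.
move=> cB e ce; apply: psi_inj; rewrite psi0; apply: cB.
apply: psi_ind => [c y|y z Ey Ez].
  by rewrite mulZr mulZl -!psiM ce.
by rewrite starDl starDr Ey Ez.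
Qed.

End Transfer.

Section OkuboAlgebra.
Variables (F : fieldType) (Fbar : closedFieldType) (iota : {rmorphism F -> Fbar}).

Lemma coord_vector_expand (I : finType) (y : {ffun I -> Fbar^o}) :
  y = \sum_p y p *: coord_vector Fbar p.
Proof.
apply/ffunP => r; rewrite sum_ffunE (bigD1 r) //= big1 => [|p pr]; rewrite !ffunE.
  by rewrite eqxx addr0 [RHS]mulr1.
by rewrite eq_sym (negPf pr) [LHS]mulr0.
Qed.

Lemma base_change_vec_inj (A : normed_algebra F) :
  injective (@base_change_vec F Fbar iota A).
Proof.
move=> x y /ffunP xy; rewrite (coord_vbasis (memvf x)) (coord_vbasis (memvf y)).
by apply: eq_bigr => i _; congr (_ *: _); have := xy i; rewrite !ffunE => /fmorph_inj.
Qed.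

Lemma okubo_symmetric (O : normed_algebra F) : okubo_algebra iota O ->
  symmetric_composition O /\ trivial_center O.
Proof.
case=> f [f_bij fM f_norm]; have f_inj := bij_inj f_bij; case: f_bij => g fK gK.
pose psi (x : O) := f (base_change_vec iota x).
have psiP a x y : psi (a *: x + y) = iota a *: psi x + psi y.
  by rewrite /psi base_change_linear linearP.
have psiM x y : psi (x ** y) = psi x ** psi y by rewrite /psi base_change_mul fM.
have psi_norm x : norm_of (psi x) = iota (norm_of x).
  by rewrite /psi f_norm base_change_norm.
have psi_inj : injective psi by move=> x y /f_inj/base_change_vec_inj.
have psi_ind (P : split_okubo Fbar -> Prop) :
    (forall c x, P (c *: psi x)) -> (forall y z, P y -> P z -> P (y + z)) ->
    forall y, P y.
  move=> PZ PD y; rewrite -[y]gK [g y]coord_vector_expand linear_sum.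
  apply: big_ind => [|//|i _]; first by rewrite -[0](scale0r (psi 0)).
  by rewrite linearZ -(base_change_basis iota); apply: PZ.
split.
  exact: (symmetric_composition_transfer psiP psiM psi_norm psi_inj psi_ind
    (split_symmetric _)).
exact: (trivial_center_transfer psiP psiM psi_inj psi_ind (@split_trivial_center _)).
Qed.

Lemma cube_root (x : Fbar) : exists y, y ^+ 3 = x.
Proof.
have [y] := @solve_monicpoly Fbar 3 (fun i => if i == 0%N then x else 0) isT.
rewrite !big_ord_recr big_ord0 /= expr0 mulr1 !mul0r !addr0 add0r => <-.
by exists y.
Qed.

(** With cube roots of alpha and beta, [okubo_ab] embeds in the split algebra and spans it. *)
Lemma okubo_ab_symmetric (alpha beta : F) : alpha != 0 -> beta != 0 ->
  symmetric_composition (okubo_ab alpha beta).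
Proof.
move=> al0 be0; have [a a3] := cube_root (iota alpha).
have [b b3] := cube_root (iota beta).
pose psi : okubo_ab alpha beta -> split_okubo Fbar := okubo_ab_embed iota a b.
have psi_ind (P : split_okubo Fbar -> Prop) :
    (forall c x, P (c *: psi x)) -> (forall y z, P y -> P z -> P (y + z)) ->
    forall y, P y.
  move=> PZ PD; apply: split_ind => // [|c p p0].
    by rewrite -[0](scale0r (psi 0)).
  have a0 : a != 0.
    by apply: contraNneq al0 => a0; rewrite -(fmorph_eq0 iota) -a3 a0 expr0n.
  have b0 : b != 0.
    by apply: contraNneq be0 => b0; rewrite -(fmorph_eq0 iota) -b3 b0 expr0n.
  have := PZ (c / (a ^+ p.1 * b ^+ p.2)) (okubo_z F p).
  rewrite -[p]/(val (Sub p p0 : okubo_index)) /psi okubo_ab_embed_z scalerA divfK //.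
  by rewrite mulf_neq0 ?expf_neq0.
apply: (symmetric_composition_transfer _ _ _ _ psi_ind (split_symmetric _)).
- exact: okubo_ab_embed_linear.
- exact: okubo_ab_embed_mul.
- exact: okubo_ab_embed_norm.
- exact: okubo_ab_embed_inj.
Qed.

Lemma dim_okubo (O : normed_algebra F) : okubo_algebra iota O ->
  \dim {:O} = #|okubo_index|.
Proof.
case=> f [[g fK gK] _ _].
pose h := linfun f.
have h_inj : lker h == 0%VS.
  by apply/lker0P => x y; rewrite !lfunE => /(can_inj fK).
have : limg h = fullv.
  apply/eqP; rewrite eqEsubv subvf; apply/subvP => y _.
  by rewrite -[y]gK -[f _](lfunE f) memv_img ?memvf.
move/(congr1 (fun U => \dim U)); rewrite limg_dim_eq ?(eqP h_inj) ?capv0 //.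
by rewrite !dimvf /dim /= !muln1 card_ord => <-; rewrite dimvf.
Qed.

End OkuboAlgebra.

(** * The isomorphism determined by two generators *)

Section Presentation.
Variables (F : fieldType) (O : normed_algebra F).
Hypothesis symO : symmetric_composition O.
Variables u v : O.
Hypotheses (nu : norm_of u = 0) (gu : cubic u != 0) (dv : deg1 u v) (gv : cubic v != 0).
Local Notation Oab := (okubo_ab (cubic u) (cubic v)).
Hypotheses (symOab : symmetric_composition Oab) (dimO : \dim {:O} = #|okubo_index|).

Definition presentation (x : Oab) : O := \sum_p x p *: okubo_basis u v (val p).

Lemma presentation_linear : linear presentation.
Proof.
move=> a x y; rewrite /presentation scaler_sumr -big_split; apply: eq_bigr => p _.
by rewrite !ffunE scalerDl scalerA.
Qed.

HB.instance Definition _ :=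
  GRing.isLinear.Build F Oab O *:%R presentation presentation_linear.

Lemma presentation_z p : presentation (okubo_z F p) = okubo_basis u v p.
Proof.
rewrite /presentation; have [->|p0] := eqVneq p 0.
  by rewrite okubo_z0 big1 // => r _; rewrite ffunE scale0r.
rewrite (bigD1 (Sub p p0 : okubo_index)) //= big1 => [|r rp].
  by rewrite ffunE eqxx scale1r addr0.
by rewrite ffunE -[p]/(val (Sub p p0 : okubo_index)) val_eqE (negPf rp) scale0r.
Qed.

Lemma presentation_mul x y : presentation (x ** y) = presentation x ** presentation y.
Proof.
rewrite {2 3}/presentation mul_expand /= /bilin_ext linear_sum; apply: eq_bigr => p _.
rewrite linear_sum; apply: eq_bigr => r _; rewrite !linearZ /=; congr (_ *: _).
by rewrite presentation_z okubo_basis_mul ?(valP p) ?(valP r).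
Qed.

(** The product determines the norm: [(x ** y) ** x = n x *: y] is compared on both sides for [y]
    mapping to [u]. *)
Lemma presentation_norm x : norm_of (presentation x) = norm_of x.
Proof.
case: symO => + _ _ _; case: symOab => + _ _ _ => E /(_ (presentation x) u).
have <- : presentation (okubo_z F (1, 0)) = u by rewrite presentation_z.
rewrite -!presentation_mul E linearZ /= presentation_z /=.
move/eqP; rewrite -subr_eq0 -scalerBl scaler_eq0 subr_eq0 => /orP[/eqP//|/eqP u0].
by move: gu; rewrite [u]u0 /cubic polar0l eqxx.
Qed.

Lemma presentation_inj : injective presentation.
Proof.
have polarE x y : polar norm_of (presentation x) (presentation y) = polar norm_of x y.
  by rewrite /polar -linearD !presentation_norm.
by move=> x y xy; apply: (polar_inj symOab) => z; rewrite -!polarE xy.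
Qed.

Lemma presentation_isomorphic : isomorphic O Oab.
Proof.
pose h := linfun presentation.
have h_inj : lker h == 0%VS.
  by apply/lker0P => x y; rewrite !lfunE => /presentation_inj.
have h_surj : limg h = fullv.
  apply/eqP; rewrite eqEdim subvf limg_dim_eq ?(eqP h_inj) ?capv0 // dimO.
  by rewrite dimvf /dim /= muln1.
have hK : cancel h (h^-1)%VF by apply: lker0_lfunK.
have Kh : cancel (h^-1)%VF h by move=> y; rewrite limg_lfunVK // h_surj memvf.
have hE x : h x = presentation x by rewrite lfunE.
exists (h^-1)%VF; split=> [|x y|x].
- by exists h.
- by apply: (can_inj hK); rewrite Kh !hE presentation_mul -!hE !Kh.
- by rewrite -presentation_norm -hE Kh.
Qed.

End Presentation.

(** * The three implications *)

Lemma isotropic_isomorphic (F : fieldType) (Fbar : closedFieldType)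
    (iota : {rmorphism F -> Fbar}) (O : normed_algebra F) :
  okubo_algebra iota O -> isotropic_norm O ->
  exists alpha beta : F,
    [/\ alpha != 0, beta != 0 & isomorphic O (okubo_ab alpha beta)].
Proof.
move=> okO isoO; have [symO cO] := okubo_symmetric okO.
have [u [v [nu gu dv gv]]] := exists_generators symO cO isoO.
exists (cubic u), (cubic v); split=> //.
apply: presentation_isomorphic => //; first exact: (okubo_ab_symmetric iota).
exact: (dim_okubo okO).
Qed.

Lemma okubo_ab_mul_z (F : fieldType) (alpha beta : F) p r : p != 0 -> r != 0 ->
  (okubo_z F p : okubo_ab alpha beta) ** okubo_z F r
  = (okubo_eps F p r * okubo_coef alpha beta p r) *: okubo_z F (p + r).
Proof.
move=> p0 r0.
have zE s (s0 : s != 0) : okubo_z F s = coord_vector F (Sub s s0 : okubo_index).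
  by apply/ffunP => k; rewrite !ffunE; congr _%:R.
by rewrite (zE p p0) (zE r r0) table_mul.
Qed.

Lemma okubo_ab_special_grading (F : fieldType) (O : normed_algebra F) alpha beta :
  isomorphic O (okubo_ab alpha beta) ->
  exists (G : zmodType) (Gamma : G -> {vspace O}), grading Gamma /\ special Gamma.
Proof.
case=> f [[g fK gK] fM _].
pose z p := g (okubo_z F p : okubo_ab alpha beta).
have fz p : f (z p) = okubo_z F p by rewrite /z gK.
have f_inj := can_inj fK.
have z0 : z 0 = 0 by apply: f_inj; rewrite fz linear0 okubo_z0.
(* The degree of each basis vector is its index; the convention that [okubo_z] vanishes at 0 makes
   the neutral component zero. *)
exists ('Z_3 * 'Z_3)%type, (fun p => <[z p]>%VS); split; last by rewrite /special z0.
split=> [x|s w s_uniq wz w0 p ps|p r _ _ /vlineP[a ->] /vlineP[c ->]].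
- exists (map val (enum okubo_index)).
  have -> : x = \sum_(r : okubo_index) f x r *: z (val r).
    apply: f_inj; rewrite linear_sum [LHS](@split_expand F).
    by apply: eq_bigr => r _; rewrite linearZ fz.
  by rewrite big_map big_enum; apply: memv_sumr => r _; apply/rpredZ/memv_line.
- have [p0|p0] := eqVneq p 0.
    by have := wz p; rewrite p0 z0 memv0 => /eqP.
  have /vlineP[a Ea] := wz p.
  have := congr1 (fun x => f x (Sub p p0 : okubo_index)) w0.
  rewrite linear_sum linear0 sum_ffunE (bigD1_seq p) //= big1 => [|q qp].
    by rewrite Ea linearZ fz !ffunE eqxx addr0 [_ *: _]mulr1 => ->; rewrite scale0r.
  have /vlineP[c ->] := wz q.
  by rewrite linearZ fz !ffunE /= eq_sym (negPf qp) scaler0.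
- rewrite mulZl mulZr; do 2!apply: rpredZ.
  have [->|p0] := eqVneq p 0; first by rewrite z0 star0l mem0v.
  have [->|r0] := eqVneq r 0; first by rewrite z0 star0r mem0v.
  apply/vlineP; exists (okubo_eps F p r * okubo_coef alpha beta p r).
  by apply: f_inj; rewrite fM linearZ !fz okubo_ab_mul_z.
Qed.

Lemma special_grading_isotropic (F : fieldType) (O : normed_algebra F)
    (G : zmodType) (Gamma : G -> {vspace O}) (u : O) :
  symmetric_composition O -> u != 0 -> grading Gamma -> special Gamma ->
  isotropic_norm O.
Proof.
case=> _ x_yx _ _ u0 [span indep mulG] G0.
have [g [x [x0 xg]]] : exists g x, x != 0 /\ x \in Gamma g.
  have [s us] := span u; elim: s u u0 us => [|g s IH] u u0.
    by rewrite big_nil memv0 (negPf u0).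
  rewrite big_cons => /memv_addP[x xg [y ys E]].
  have [x0|x0] := eqVneq x 0; last by exists g, x.
  by apply: (IH y) => //; move: u0; rewrite E x0 add0r.
exists x => //; apply/eqP/contraT => nx; case/negP: x0.
have x_gg : x ** x \in Gamma (g + g) by apply: mulG.
have [gg|gg] := eqVneq (g + g) 0.
  have /eqP xx : x ** x == 0 by rewrite -memv0 -G0 -gg.
  have := x_yx x x; rewrite xx star0r => /esym/eqP.
  by rewrite scaler_eq0 (negPf nx).
have x_ggg : x ** (x ** x) \in Gamma (g + (g + g)) by apply: mulG.
have ne : g + (g + g) != g by rewrite -subr_eq0 addrAC subrr add0r.
(* [n x *: x - x ** (x ** x) = 0] is read as a sum in the distinct degrees [g] and [3g], so
   independence kills [n x *: x]. *)
pose w h := if h == g then norm_of x *: x else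
  if h == g + (g + g) then - (x ** (x ** x)) else 0.
have := indep [:: g; g + (g + g)] w.
rewrite /= inE eq_sym ne !big_cons big_nil /w eqxx (negPf ne) eqxx addr0 x_yx subrr.
move=> /(_ isT) H; have := H _ erefl g.
rewrite inE eqxx => /(_ _ isT)/eqP; rewrite scaler_eq0 (negPf nx) /=; apply.
move=> h; case: eqP => [->|_]; first exact: rpredZ.
by case: eqP => [->|_]; rewrite ?mem0v // -(x_yx x) rpredN.
Qed.

Theorem theorem4p2 (F : fieldType) (Fbar : closedFieldType)
    (iota : {rmorphism F -> Fbar}) (Fbar_alg : algebraic_extension iota)
    (O : normed_algebra F) (O_okubo : okubo_algebra iota O) :
  [<-> isotropic_norm O;
       exists alpha beta : F,
         [/\ alpha != 0, beta != 0 & isomorphic O (okubo_ab alpha beta)];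
       exists (G : zmodType) (Gamma : G -> {vspace O}),
         grading Gamma /\ special Gamma].
Proof.
tfae; first exact: (isotropic_isomorphic O_okubo).
  by case=> alpha [beta [_ _ /okubo_ab_special_grading]].
case=> G [Gamma [gradG speG]]; have [symO _] := okubo_symmetric O_okubo.
apply: (special_grading_isotropic symO _ gradG speG (u := vpick {:O})).
rewrite vpick0 -dimv_eq0 (dim_okubo O_okubo) -lt0n.
by apply/card_gt0P; exists (Sub (1, 0) isT).
Qed.
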